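(* The problem Timeline Vertex Cover is NP-hard, even when restricted to instances with $T=23$, $k=2$, $\ell=4$, and maximum snapshot degree at most one.
   Context: A temporal graph $\mathcal{G}=(G_1,\dots,G_T)$ is a finite sequence of simple undirected graphs (snapshots) on a common finite vertex set $V$; $T$ is its lifetime and $E_i=E(G_i)$. A temporal edge is a pair $(e,i)$ with $e\in E_i$. An activity interval is a triple $(v,a,b)$ with $v\in V$, $a,b\in\{1,\dots,T\}$, $a\le b$; its length is $b-a$. A $k$-activity $\ell$-timeline is a set of activity intervals containing at most $k$ intervals for each vertex, each of length at most $\ell$. A vertex $v$ is active at time $i$ if the timeline contains some $(v,a,b)$ with $a\le i\le b$. The timeline covers the temporal edge $(uv,i)$ if $u$ or $v$ is active at time $i$. The maximum snapshot degree is $\max_i \Delta(G_i)$. Timeline Vertex Cover: given $\mathcal{G}$ and integers $k\ge1$, $\ell\ge0$, decide whether there is a $k$-activity $\ell$-timeline covering all temporal edges of $\mathcal{G}$. *)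

(* Defs.v *)
From HB Require Import structures.
From mathcomp Require Import all_boot.

Set Implicit Arguments.
Unset Strict Implicit.
Unset Printing Implicit Defensive.

(** * Turing machines, NP and NP-hardness *)

Definition word := seq bool.
Definition language := word -> Prop.

Inductive move := MoveLeft | Stay | MoveRight.

Definition move_code (m : move) : option bool :=
  match m with MoveLeft => Some false | Stay => None | MoveRight => Some true end.
Definition move_decode (o : option bool) : move :=
  match o with Some false => MoveLeft | None => Stay | Some true => MoveRight end.
Lemma move_codeK : cancel move_code move_decode.
Proof. by case. Qed.
HB.instance Definition _ := Finite.copy move (can_type move_codeK).

(* Nondeterministic Turing machine with ntapes.+1 tapes, infinite in both
   directions.  The input is given on the first tape and the output is read on
   the last one (the same tape when ntapes = 0). *)
Record machine := Machine {
  ntapes : nat;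
  state : finType;
  symbol : finType;
  blank : symbol;
  letter : bool -> symbol;
  letter_inj : injective letter;
  letter_neq_blank : forall b, letter b != blank;
  start : state;
  final : pred state;
  trans : state -> {ffun 'I_ntapes.+1 -> symbol} ->
          {set state * {ffun 'I_ntapes.+1 -> symbol * move}}
}.

Definition deterministic (M : machine) : Prop :=
  forall (q : state M) (s : {ffun 'I_(ntapes M).+1 -> symbol M}),
    #|trans q s| <= 1.

(* tape_left lists the cells to the left of the head, nearest one first; all
   cells outside the two lists are blank. *)
Record tape (A : Type) := Tape {
  tape_left : seq A;
  tape_head : A;
  tape_right : seq A
}.

Definition tape_of (A : Type) (b : A) (s : seq A) : tape A :=
  Tape [::] (head b s) (behead s).

Definition tape_cells (A : Type) (t : tape A) : seq A :=
  rev (tape_left t) ++ tape_head t :: tape_right t.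

Definition tape_act (A : Type) (b : A) (t : tape A) (a : A * move) : tape A :=
  let: Tape l _ r := t in
  match a.2 with
  | Stay => Tape l a.1 r
  | MoveLeft => Tape (behead l) (head b l) (a.1 :: r)
  | MoveRight => Tape (a.1 :: l) (head b r) (behead r)
  end.

Record config (M : machine) := Config {
  cstate : state M;
  ctapes : {ffun 'I_(ntapes M).+1 -> tape (symbol M)}
}.

Definition init (M : machine) (w : word) : config M :=
  Config (start M)
    [ffun i => tape_of (blank M)
                 (if i == ord0 then [seq letter M b | b <- w] else [::])].

Definition scanned (M : machine) (c : config M) :
    {ffun 'I_(ntapes M).+1 -> symbol M} :=
  [ffun i => tape_head (ctapes c i)].

(* Final configurations have no successor; this is what makes the result of a
   deterministic machine unique. *)
Definition step (M : machine) (c c' : config M) : Prop :=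
  ~~ final (cstate c) /\
  exists2 a, a \in trans (cstate c) (scanned c) &
    c' = Config a.1 [ffun i => tape_act (blank M) (ctapes c i) (a.2 i)].

Fixpoint reaches (M : machine) (n : nat) (c c' : config M) : Prop :=
  if n is m.+1 then exists2 c1, step c c1 & reaches m c1 c' else c = c'.

Definition output (M : machine) (c : config M) (w : word) : Prop :=
  exists i j : nat,
    tape_cells (ctapes c ord_max) =
      nseq i (blank M) ++ [seq letter M b | b <- w] ++ nseq j (blank M).

Definition poly_time (f : word -> word) : Prop :=
  exists (M : machine) (a d : nat), deterministic M /\
    forall w : word, exists (n : nat) (c : config M),
      [/\ n <= a * size w ^ d + a, reaches n (init M w) c,
          final (cstate c) & output c (f w)].

Definition NP (L : language) : Prop :=
  exists (M : machine) (a d : nat), forall w : word,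
    L w <-> exists (n : nat) (c : config M),
      [/\ n <= a * size w ^ d + a, reaches n (init M w) c & final (cstate c)].

Record decision_problem := DecisionProblem {
  instance : Type;
  encode : instance -> word;
  encode_inj : injective encode;
  yes : instance -> Prop
}.

Definition NP_hard (P : decision_problem) : Prop :=
  forall L : language, NP L ->
    exists f : word -> instance P,
      poly_time (fun w => encode (f w)) /\ forall w, L w <-> yes (f w).

Lemma restrict_encode_inj (P : decision_problem) (C : pred (instance P)) :
  injective (fun I : {I : instance P | C I} => encode (sval I)).
Proof.
move=> [I CI] [J CJ] /= /encode_inj eIJ.
by case: J / eIJ CJ => CJ; rewrite (bool_irrelevance CI CJ).
Qed.

Definition restrict (P : decision_problem) (C : pred (instance P)) :
    decision_problem :=
  DecisionProblem (@restrict_encode_inj P C) (fun I => yes (sval I)).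

(** * Timeline Vertex Cover *)

Record simple_graph (V : finType) := SimpleGraph {
  edges : {set {set V}};
  edges_card2 : [forall e in edges, #|e| == 2]
}.

(* The times 1, ..., T are represented by 'I_T, i.e. shifted to 0, ..., T - 1. *)
Definition temporal_graph (V : finType) (T : nat) :=
  {ffun 'I_T -> simple_graph V}.

Definition degree (V : finType) (G : simple_graph V) (v : V) : nat :=
  #|[set e in edges G | v \in e]|.

Definition max_snapshot_degree (V : finType) (T : nat)
    (G : temporal_graph V T) : nat :=
  \max_(i < T) \max_(v : V) degree (G i) v.

(* Raw triples (v, a, b) = ((v, a), b); the requirement a <= b is part of
   is_timeline. *)
Definition activity_interval (V : finType) (T : nat) : finType :=
  (V * 'I_T * 'I_T)%type.

Definition is_timeline (V : finType) (T k l : nat)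
    (S : {set activity_interval V T}) : Prop :=
  (forall v a b, (v, a, b) \in S -> a <= b /\ b - a <= l) /\
  (forall v, #|[set I in S | I.1.1 == v]| <= k).

Definition active (V : finType) (T : nat) (S : {set activity_interval V T})
    (v : V) (i : 'I_T) : Prop :=
  exists a b, (v, a, b) \in S /\ a <= i <= b.

Definition covers (V : finType) (T : nat) (S : {set activity_interval V T})
    (e : {set V}) (i : 'I_T) : Prop :=
  exists2 v, v \in e & active S v i.

Record tvc_instance := TVCInstance {
  num_vertices : nat;
  lifetime : nat;
  tgraph : temporal_graph 'I_num_vertices lifetime;
  activity : nat;
  max_length : nat;
  activity_gt0 : 0 < activity
}.

Definition tvc_yes (I : tvc_instance) : Prop :=
  exists S : {set activity_interval 'I_(num_vertices I) (lifetime I)},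
    is_timeline (activity I) (max_length I) S /\
    forall i e, e \in edges (tgraph I i) -> covers S e i.

Definition unary (n : nat) : word := rcons (nseq n true) false.

Definition adjacency (n : nat) (G : simple_graph 'I_n) : word :=
  [seq [set u; v] \in edges G | u <- enum 'I_n, v <- enum 'I_n].

(* Unary is harmless: the size of the rest already grows with the number of
   vertices and the lifetime, and only activities and lengths up to the lifetime
   matter.  The adjacency matrices are listed row by row. *)
Definition tvc_encode (I : tvc_instance) : word :=
  unary (num_vertices I) ++ unary (lifetime I) ++
  unary (activity I) ++ unary (max_length I) ++
  flatten [seq adjacency (tgraph I i) | i <- enum 'I_(lifetime I)].

Lemma unary_cat_inj (m n : nat) (s t : word) :
  unary m ++ s = unary n ++ t -> m = n /\ s = t.
Proof.
rewrite /unary; elim: m n => [|m IHm] [|n] //=; first by case.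
by case=> /IHm [-> ->].
Qed.

Lemma edges_inj (V : finType) : injective (@edges V).
Proof.
move=> [E HE] [F HF] /= eEF.
by case: F / eEF HF => HF; rewrite (bool_irrelevance HE HF).
Qed.

Lemma flatten_map_inj (I : eqType) (s : seq I) (F G : I -> word) :
  (forall i, size (F i) = size (G i)) ->
  flatten (map F s) = flatten (map G s) -> {in s, F =1 G}.
Proof.
move=> eqs; elim: s => [|i s IHs] //= /eqP.
rewrite eqseq_cat // => /andP[/eqP eFG /eqP /IHs {}IHs] j.
by rewrite inE => /predU1P[->|/IHs].
Qed.

Lemma adjacency_inj (n : nat) : injective (@adjacency n).
Proof.
move=> G H /flatten_map_inj eGH; apply: edges_inj; apply/setP => e.
have {}eGH u v : ([set u; v] \in edges G) = ([set u; v] \in edges H).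
  have /eq_in_map E := eGH (fun=> etrans (size_map _ _) (esym (size_map _ _)))
                           u (mem_enum _ _).
  exact: E (mem_enum _ _).
have [/cards2P[u [v [_ ->]]]//|ne2] := boolP (#|e| == 2).
have notin K : e \notin edges K.
  by apply: contra ne2 => /(forall_inP (edges_card2 K)).
by rewrite !(negbTE (notin _)).
Qed.

Lemma tvc_encode_inj : injective tvc_encode.
Proof.
move=> [n T G k l k0] [n' T' G' k' l' k0']; rewrite /tvc_encode /=.
case/unary_cat_inj=> en; case/unary_cat_inj=> eT.
case/unary_cat_inj=> ek; case/unary_cat_inj=> el.
subst n' T' k' l' => eG; rewrite (bool_irrelevance k0' k0).
suff -> : G = G' by [].
apply/ffunP => i; apply: adjacency_inj.
apply: (flatten_map_inj _ eG); last exact: mem_enum.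
by move=> j; rewrite !size_allpairs.
Qed.

Definition TVC : decision_problem := DecisionProblem tvc_encode_inj tvc_yes.

(* Main.v *)
From HB Require Import structures.
Require Import Defs.
From mathcomp Require Import all_boot zify.

Set Implicit Arguments.
Unset Strict Implicit.
Unset Printing Implicit Defensive.

(** The accepting computations of a nondeterministic machine are described by a
    CNF formula whose variables guess the rule applied at each time and the
    contents of each tape, seen from its head.  The formula is given by its
    incidence matrix (clauses x variables).  Each entry (j, v) of the matrix
    becomes a cell of eight vertices, built from two facts on a vertex with two
    intervals of length at most 4: it is active at most 10 times, and never at
    three times that are pairwise at distance at least 5.  By the first one, a
    pair of vertices joined at 20 of the 23 times is inactive at the other
    three, where it forces its neighbours to be active; by the second one, a
    vertex with one forced time can choose only one of two distant times (a
    truth value) and a vertex with three distant edges cannot cover them all (a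
    ternary clause).  Truth values are copied down the columns and long clauses
    are split along the rows.  A vertex has at most one neighbour in each
    snapshot, and this neighbour lies in the same or an adjacent cell, so the
    adjacency matrices are written by a loop program on counters, which a
    multitape machine follows step by step, one tape per counter. *)

(** * From CNF incidence matrices to temporal graphs *)

(** The whole construction is shaped by the fact that the reduction itself must be carried out by a
    Turing machine. The matrix is therefore dense, one cell for every clause and every variable,
    with [Zero] for an absent literal and [Tru] for a clause that holds trivially: no list of
    occurrences has to be computed, and the number of a neighbour differs from that of the vertex by
    an offset taken from a short fixed list. Looking at the tapes from their heads serves the same
    end: a move shifts every cell by at most one position, no variable records a head position, and
    for given kinds of clause and variable an entry depends on fifteen bits, whatever the input. The
    lifetime is 20 + 3: two vertices have 2 * 10 active times between them, all spent on their 20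
    common edges, and a ternary clause needs three times free of such edges. Each row needs its own
    copy of every literal because, with snapshot degree one, a literal can meet only one clause
    vertex at time 0. *)

Variant entry := Zero | Pos | Neg | Tru.

Definition lit_true (e : entry) (b : bool) : bool :=
  match e with Zero => false | Pos => b | Neg => ~~ b | Tru => true end.

Definition cnf_sat (J V : nat) (A : nat -> nat -> entry) : Prop :=
  exists sigma : nat -> bool, forall j, j < J ->
    exists2 v, v < V & lit_true (A j v) (sigma v).

Variant shift := Here | NextRow | PrevRow | NextCol | PrevCol.

(* Vertices of a cell: 0 and 1 are the literals x and ~x (true: active at
   0, 1, 2; false: active at 7, 8), 2 is the prefix variable y, true if one of
   the literals before column v holds (true: active at 6; false: active at 12),
   3 is the clause y(v+1) -> y(v) \/ literal, and the pairs 4, 5 and 6, 7 force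
   times 20 and 0, 6, 12.  The result is the neighbour at time t; jf, jl, vf and
   vl tell whether the cell is in the first or last row or column. *)
Definition slot (t g : nat) (e : entry) (jf jl vf vl : bool) :
    option (shift * nat) :=
  match g with
  | 0 => match t with
         | 0 => if e is Pos then Some (Here, 3) else None
         | 1 | 7 => Some (Here, 1)
         | 2 | 8 => if jf then None else Some (PrevRow, 1)
         | 20 => Some (Here, 4)
         | _ => None
         end
  | 1 => match t with
         | 0 => if e is Neg then Some (Here, 3) else None
         | 1 | 7 => Some (Here, 0)
         | 2 | 8 => if jl then None else Some (NextRow, 0)
         | 20 => Some (Here, 5)
         | _ => None
         end
  | 2 => match t with
         | 0 => Some (Here, 7)
         | 6 => if vf then None else Some (Here, 3)
         | 12 => if vf then None else Some (PrevCol, 3)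
         | _ => None
         end
  | 3 => match t with
         | 0 => match e with
                | Pos => Some (Here, 0)
                | Neg => Some (Here, 1)
                | Zero => Some (Here, 6)
                | Tru => None
                end
         | 6 => Some (Here, if vf then 6 else 2)
         | 12 => if vl then Some (Here, 6) else Some (NextCol, 2)
         | _ => None
         end
  | 4 => if t < 20 then Some (Here, 5)
         else if t == 20 then Some (Here, 0) else None
  | 5 => if t < 20 then Some (Here, 4)
         else if t == 20 then Some (Here, 1) else None
  | 6 => match t with
         | 0 => if e is Zero then Some (Here, 3) else None
         | 6 => if vf then Some (Here, 3) else None
         | 12 => if vl then Some (Here, 3) else None
         | _ => Some (Here, 7)
         end
  | 7 => match t with
         | 0 => Some (Here, 2)
         | 6 | 12 => None
         | _ => Some (Here, 6)
         end
  | _ => None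
  end.

(** By exhaustion. Symmetry can be stated inside one cell for [Here] only, because the other cell of
    a move has its own entry and flags; for the four proper moves the lemma records the few places
    where they occur. *)
Lemma slotP t g e jf jl vf vl s g' : t < 23 ->
  slot t g e jf jl vf vl = Some (s, g') ->
  match s with
  | Here => [/\ slot t g' e jf jl vf vl = Some (Here, g), g' < 8 & g != g']
  | NextRow => [/\ jl = false, g = 1, g' = 0 & t = 2 \/ t = 8]
  | PrevRow => [/\ jf = false, g = 0, g' = 1 & t = 2 \/ t = 8]
  | NextCol => [/\ vl = false, g = 3, g' = 2 & t = 12]
  | PrevCol => [/\ vf = false, g = 2, g' = 3 & t = 12]
  end.
Proof.
case: g => [|[|[|[|[|[|[|[|g]]]]]]]] //; do 23?[case: t => [|t]]; move=> // _;
  rewrite /slot /=; try discriminate;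
  (* Only the entry and the flags that this slot inspects are destructed. *)
  repeat match goal with
  | |- ?l = _ -> _ =>
    match l with context [match ?x with _ => _ end] => is_var x; destruct x end
  end; try discriminate;
  case=> <- <-; split; by [|left|right].
Qed.

(** * The temporal graph of a CNF matrix *)

Section Gadget.
Variables (J V : nat) (A : nat -> nat -> entry).
Hypothesis V_gt0 : 0 < V.

Definition triple := (nat * nat * nat)%type.

Definition slot_at (t : nat) (x : triple) : option (shift * nat) :=
  let: (j, v, g) := x in
  slot t g (A j v) (j == 0) (j.+1 == J) (v == 0) (v.+1 == V).

Definition shifted (x : triple) (sg : shift * nat) : triple :=
  let: (j, v, _) := x in let: (s, g) := sg in
  match s with
  | Here => (j, v, g)
  | NextRow => (j.+1, v, g)
  | PrevRow => (j.-1, v, g)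
  | NextCol => (j, v.+1, g)
  | PrevCol => (j, v.-1, g)
  end.

Definition partner3 (t : nat) (x : triple) : option triple :=
  omap (shifted x) (slot_at t x).

Definition in_range (x : triple) : bool :=
  let: (j, v, g) := x in [&& j < J, v < V & g < 8].

(** A move is undone by the opposite one: the flag of the source cell ensures that the target cell
    exists, and the target cannot lie on the border that faces back to the source. *)
Lemma partner3_sym t x y : t < 23 -> in_range x ->
  partner3 t x = Some y -> [/\ in_range y, partner3 t y = Some x & x <> y].
Proof.
case: x => [[j v] g] lt23 /and3P[ltj ltv lt8].
rewrite /partner3 /slot_at.
case E: slot => [[s g']|] //= [<-].
have := slotP lt23 E; case: s {E} => /=.
- case=> -> lt8' ne; split=> //; first by rewrite ltj ltv.
  by case=> /eqP; rewrite (negbTE ne).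
- case=> /eqP jl -> -> Et; split; [lia| |by []].
  by case: Et => ->.
- case=> /eqP jf -> -> Et; split; [lia| |by []].
  case: j jf ltj => // j _ ltj /=; have -> : (j.+1 == J) = false by lia.
  by case: Et => ->.
- case=> /eqP vl -> -> ->; split; [lia|by []|by []].
- case=> /eqP vf -> -> ->; split; [lia| |by []].
  by case: v vf ltv => // v _ ltv /=; have -> : (v.+1 == V) = false by lia.
Qed.

Definition num_of (x : triple) : nat := let: (j, v, g) := x in (j * V + v) * 8 + g.
Arguments num_of : simpl never.
Definition of_num (u : nat) : triple := (u %/ 8 %/ V, u %/ 8 %% V, u %% 8).

Lemma of_numK u : num_of (of_num u) = u.
Proof. by rewrite /num_of /of_num -!divn_eq. Qed.

Lemma num_ofK x : in_range x -> of_num (num_of x) = x.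
Proof.
case: x => [[j v] g] /and3P[ltj ltv lt8]; rewrite /of_num /num_of.
have -> : ((j * V + v) * 8 + g) %/ 8 = j * V + v.
  by rewrite divnMDl // divn_small // addn0.
by rewrite divnMDl // (divn_small ltv) addn0 !modnMDl !modn_small.
Qed.

Definition gadget_order := J * V * 8.

Lemma num_of_lt x : in_range x -> num_of x < gadget_order.
Proof.
case: x => [[j v] g] /and3P[ltj ltv lt8]; rewrite /num_of /gadget_order.
have : (j * V + v).+1 <= J * V.
  by apply: leq_trans (_ : j.+1 * V <= _); [lia | rewrite leq_mul2r ltj orbT].
by lia.
Qed.

Lemma of_num_range u : u < gadget_order -> in_range (of_num u).
Proof.
move=> ltu; rewrite /= !ltn_mod V_gt0 /= andbT.
by rewrite !ltn_divLR // mulnC mulnA mulnC [8 * _]mulnC // mulnC [V * J]mulnC.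
Qed.

Definition partner (t u : nat) : option nat := omap num_of (partner3 t (of_num u)).

Lemma partner_sym t u v : t < 23 -> u < gadget_order -> partner t u = Some v ->
  [/\ v < gadget_order, partner t v = Some u & u != v].
Proof.
move=> lt23 ltu; rewrite /partner; case E: partner3 => [y|] //= [<-].
have [ry Ey ne] := partner3_sym lt23 (of_num_range ltu) E.
rewrite num_of_lt // num_ofK // Ey /= of_numK; split=> //.
by apply/eqP=> Eu; apply: ne; rewrite Eu num_ofK.
Qed.

Definition snapshot_edges (t : nat) : {set {set 'I_gadget_order}} :=
  [set e : {set 'I_gadget_order} | [exists u : 'I_gadget_order, exists v : 'I_gadget_order,
    (partner t u == Some (v : nat)) && (e == [set u; v])]].

Lemma snapshot_edgesP (t : 'I_23) (e : {set 'I_gadget_order}) :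
  reflect (exists u v : 'I_gadget_order,
    [/\ partner t u = Some (v : nat), u != v & e = [set u; v]])
    (e \in snapshot_edges t).
Proof.
rewrite inE; apply: (iffP existsP) => [[u /existsP[v /andP[/eqP Euv /eqP ->]]]|].
  by have [_ _ ?] := partner_sym (ltn_ord t) (ltn_ord u) Euv; exists u, v.
case=> u [v [Euv _ ->]]; exists u; apply/existsP; exists v.
by rewrite Euv !eqxx.
Qed.

Lemma snapshot_edges_card2 (t : 'I_23) :
  [forall e in snapshot_edges t, #|e| == 2].
Proof.
apply/forall_inP => e /snapshot_edgesP[u [v [_ ne ->]]].
by rewrite cards2 ne.
Qed.

Definition gadget_graph : temporal_graph 'I_gadget_order 23 :=
  [ffun t => SimpleGraph (snapshot_edges_card2 t)].

Definition gadget : tvc_instance :=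
  @TVCInstance gadget_order 23 gadget_graph 2 4 isT.

(** Each snapshot is a matching, so an edge determines the partner of either endpoint. In this form
    the entries of the adjacency matrices can be printed. *)
Lemma mem_gadget_edges (t : 'I_23) (u v : 'I_gadget_order) :
  ([set u; v] \in edges (gadget_graph t)) = (partner t u == Some (v : nat)).
Proof.
rewrite ffunE /=; apply/snapshot_edgesP/eqP => [[a [b [Eab nab Euv]]]|Euv]; last first.
  by exists u, v; have [_ _ ?] := partner_sym (ltn_ord t) (ltn_ord u) Euv.
have [_ Eba _] := partner_sym (ltn_ord t) (ltn_ord a) Eab.
have : u \in [set a; b] by rewrite -Euv set21.
have : v \in [set a; b] by rewrite -Euv set22.
have : #|[set u; v]| = 2 by rewrite Euv cards2 nab.
rewrite cards2; case: (altP (u =P v)) => // nuv _.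
by do 2!case/set2P=> ?; subst => //; rewrite eqxx in nuv.
Qed.

Lemma gadget_degree : max_snapshot_degree (tgraph gadget) <= 1.
Proof.
apply/bigmax_leqP => t _; apply/bigmax_leqP => v _.
have endpoint e : e \in [set e in edges (gadget_graph t) | v \in e] ->
    exists2 w : 'I_gadget_order, partner t v = Some (w : nat) & e = [set v; w].
  rewrite inE ffunE /= => /andP[/snapshot_edgesP[a [b [Eab _ ->]]]].
  case/set2P=> ->; first by exists b.
  have [_ Eba _] := partner_sym (ltn_ord t) (ltn_ord a) Eab.
  by exists a; rewrite // setUC.
apply/card_le1_eqP => e f /endpoint[w Ew ->] /endpoint[w' Ew' ->].
by move: Ew'; rewrite Ew => -[/val_inj ->].
Qed.

(** * From a covering timeline to a satisfying assignment *)

Section Sound.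
Variable S : {set activity_interval 'I_gadget_order 23}.
Hypothesis timelineS : is_timeline 2 4 S.
Hypothesis coverS : forall i e, e \in edges (gadget_graph i) -> covers S e i.

Definition act (x : triple) (t : nat) : bool :=
  [exists I in S, ((I.1.1 : nat) == num_of x) && (I.1.2 <= t <= I.2)].

Lemma act_cover t x y : t < 23 -> in_range x -> partner3 t x = Some y ->
  act x t || act y t.
Proof.
move=> lt23 rx Exy; have [ry _ _] := partner3_sym lt23 rx Exy.
pose u := Ordinal (num_of_lt rx); pose v := Ordinal (num_of_lt ry).
have : [set u; v] \in edges (gadget_graph (Ordinal lt23)).
  by rewrite mem_gadget_edges /partner /= num_ofK // Exy.
case/coverS=> w /set2P Ew [a [b [Sab /= abt]]].
have actw z : (w : nat) = num_of z -> act z t.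
  by move=> Ez; apply/exists_inP; exists (w, a, b); rewrite //= Ez eqxx.
by case: Ew => Ew; apply/orP; [left|right]; apply: actw; rewrite Ew.
Qed.

Lemma act_range x t : act x t -> num_of x < gadget_order.
Proof. by case/exists_inP=> I _ /andP[/eqP <- _]. Qed.

(** An interval of length at most 4 contains no two times at distance 5, so three such times would
    need three intervals. *)
Lemma act_spread x t1 t2 t3 : t1 + 5 <= t2 -> t2 + 5 <= t3 ->
  act x t1 -> act x t2 -> act x t3 -> False.
Proof.
move=> le12 le23 act1; have ltx := act_range act1.
have [len card2] := timelineS.
case/exists_inP: act1 => -[[u1 a1] b1] S1 /= /andP[/eqP E1 t1P].
case/exists_inP=> -[[u2 a2] b2] S2 /= /andP[/eqP E2 t2P].
case/exists_inP=> -[[u3 a3] b3] S3 /= /andP[/eqP E3 t3P].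
have [_ l1] := len _ _ _ S1; have [_ l2] := len _ _ _ S2.
have [_ l3] := len _ _ _ S3.
have := card2 (Ordinal ltx); rewrite leqNgt => /negP; apply; apply/card_gt2P.
exists (u1, a1, b1), (u2, a2, b2), (u3, a3, b3).
rewrite !inE S1 S2 S3 -!val_eqE /= E1 E2 E3 eqxx; split=> //.
by split; apply/eqP=> -[_ Ea Eb]; subst; lia.
Qed.

Lemma card_act x : #|[set t : 'I_23 | act x t]| <= 10.
Proof.
have [ltx|gex] := ltnP (num_of x) gadget_order; last first.
  rewrite (eq_card0 (A := [set _ | _])) // => t.
  rewrite !inE; apply/negbTE/negP => a; move: (act_range a).
  by rewrite ltnNge gex.
have [len /(_ (Ordinal ltx)) card2] := timelineS.
pose SX := [set I in S | I.1.1 == Ordinal ltx].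
have sub : [set t : 'I_23 | act x t] \subset
    \bigcup_(I in SX) [set t : 'I_23 | I.1.2 <= t <= I.2].
  apply/subsetP => t; rewrite inE => /exists_inP[I SI /andP[EI tI]].
  by apply/bigcupP; exists I; rewrite inE // SI -val_eqE.
apply: leq_trans (subset_leq_card sub) _.
apply: (@leq_trans (\sum_(I in SX) 5)); last first.
  by rewrite sum_nat_const (leq_mul2r 5 _ 2) card2.
have: forall I, I \in SX -> #|[set t : 'I_23 | I.1.2 <= t <= I.2]| <= 5.
  move=> [[u a] b]; rewrite inE /= => /andP[/len[_ lab] _].
  (* The offset from the start of the interval embeds its times in ['I_5]. *)
  pose f (t : 'I_23) : 'I_5 := inord (t - a).
  have injf : {in [set t : 'I_23 | a <= t <= b] &, injective f}.
    move=> t t'; rewrite !inE => tP tP' /(congr1 val) /=.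
    by rewrite !inordK ?ltnS; [move=> ?; apply: val_inj => /=; lia|lia|lia].
  by rewrite -(card_in_imset injf) (leq_trans (max_card _)) ?card_ord.
move=> le5; elim/big_rec2: _ => [|I k B SI IH]; first by rewrite cards0.
by apply: leq_trans (leq_card_setU _ _) _; rewrite leq_add ?le5.
Qed.

(** If [x] spent one of its 10 times on [h], at most 9 + 10 times would be left for the 20 elements
    of [X]. *)
Lemma act_dead x y (X : {set 'I_23}) (h : 'I_23) : 20 <= #|X| ->
  (forall t, t \in X -> act x t || act y t) -> h \notin X -> ~~ act x h.
Proof.
move=> cardX covX hX; apply/negP=> actx.
have: X \subset ([set t : 'I_23 | act x t] :\ h) :|: [set t : 'I_23 | act y t].
  apply/subsetP=> t tX; rewrite !inE.
  have -> /= : t != h by apply: contraNneq hX => <-.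
  exact: covX.
have cx : #|[set t : 'I_23 | act x t] :\ h| <= 9.
  by have := card_act x; rewrite [#|[set t : 'I_23 | act x t]|](cardsD1 h) inE actx.
move/subset_leq_card => /leq_trans /(_ (leq_card_setU _ _)) /(leq_trans cardX).
by rewrite leqNgt ltnS (leq_add cx (card_act y)).
Qed.

Variables j v : nat.
Hypotheses (ltj : j < J) (ltv : v < V).

Lemma cell_range g : g < 8 -> in_range (j, v, g).
Proof. by rewrite /= ltj ltv. Qed.

Lemma forcer_dead t : t \in [:: 20; 21; 22] ->
  ~~ act (j, v, 4) t /\ ~~ act (j, v, 5) t.
Proof.
move=> tP; pose X := [set t : 'I_23 | t < 20].
have cardX : 20 <= #|X|.
  by rewrite cardsE -sum1_card big_mkcond /= !big_ord_recr /= big_ord0.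
have lt23 : t < 23 by move: tP; rewrite !inE; lia.
have hX : Ordinal lt23 \notin X by move: tP; rewrite !inE /=; lia.
have cov (i : 'I_23) : i \in X -> act (j, v, 4) i || act (j, v, 5) i.
  rewrite inE => lti; apply: act_cover => //; first exact: cell_range.
  by rewrite /partner3 /slot_at /slot lti.
split; first exact: (act_dead cardX cov hX).
by apply: (act_dead (y := (j, v, 4)) cardX _ hX) => i; rewrite orbC; apply: cov.
Qed.

Lemma clause_forcer_dead t : t \in [:: 0; 6; 12] ->
  ~~ act (j, v, 6) t /\ ~~ act (j, v, 7) t.
Proof.
move=> tP; pose X := [set t : 'I_23 | (t : nat) \notin [:: 0; 6; 12]].
have cardX : 20 <= #|X|.
  by rewrite cardsE -sum1_card big_mkcond /= !big_ord_recr /= big_ord0.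
have lt23 : t < 23 by move: tP; rewrite !inE; lia.
have hX : Ordinal lt23 \notin X by rewrite inE /= negbK.
have cov (i : 'I_23) : i \in X -> act (j, v, 6) i || act (j, v, 7) i.
  rewrite inE => iP; apply: act_cover => //; first exact: cell_range.
  rewrite /partner3 /slot_at.
  by case: i iP => i /= _; do 13?[case: i => [|i] //].
split; first exact: (act_dead cardX cov hX).
by apply: (act_dead (y := (j, v, 6)) cardX _ hX) => i; rewrite orbC; apply: cov.
Qed.


(** The edge to the forcer [g + 4], which is inactive at 20, makes the literal active at 20; then
    [a], [b], 20 would be three spread times. *)
Lemma literal_excl g a b : g < 2 -> a + 5 <= b -> b + 5 <= 20 ->
  act (j, v, g) a -> ~~ act (j, v, g) b.
Proof.
move=> lt2 lab lb acta; apply/negP=> actb.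
have [dead4 dead5] : _ /\ _ := @forcer_dead 20 isT.
have act20 : act (j, v, g) 20.
  have := @act_cover 20 (j, v, g) (j, v, g + 4) isT.
  rewrite (@cell_range g) => [/(_ isT)|]; last by lia.
  by case: g lt2 {acta actb} => [|[|]] //= _ /(_ erefl);
    rewrite ?(negbTE dead4) ?(negbTE dead5) orbF.
exact: act_spread lab lb acta actb act20.
Qed.

Lemma literal_cover t : t \in [:: 1; 7] -> act (j, v, 0) t || act (j, v, 1) t.
Proof.
move=> tP; apply: act_cover; rewrite ?cell_range //.
  by move: tP; rewrite !inE; lia.
by move: tP; rewrite !inE => /orP[]/eqP->.
Qed.

Lemma literal_cover_next t : j.+1 < J -> t \in [:: 2; 8] ->
  act (j, v, 1) t || act (j.+1, v, 0) t.
Proof.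
move=> ltj1 tP; apply: act_cover; rewrite ?cell_range //.
  by move: tP; rewrite !inE; lia.
have ne : (j.+1 == J) = false by lia.
by move: tP; rewrite /partner3 /= !inE => /orP[]/eqP-> /=; rewrite ne.
Qed.

(** Vertex 7 is inactive at 0, so vertex 2 has to cover their edge there; the times 0, 6, 12 are
    spread. *)
Lemma prefix_excl : act (j, v, 2) 12 -> ~~ act (j, v, 2) 6.
Proof.
move=> act12; apply/negP=> act6; have [_ dead7] := @clause_forcer_dead 0 isT.
have := @act_cover 0 (j, v, 2) (j, v, 7) isT (@cell_range 2 isT) erefl.
rewrite (negbTE dead7) orbF => act0.
exact: (@act_spread (j, v, 2) 0 6 12).
Qed.

End Sound.

(** The value of a variable is read off its vertex 0 at time 7. In a row without a true literal,
    every clause vertex is busy at 0, and this drives the activity from left to right until the last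
    clause vertex would need all of 0, 6, 12. *)
Lemma gadget_sound : tvc_yes gadget -> cnf_sat J V A.
Proof.
case=> S [timelineS coverS].
pose x j v := ~~ act S (j, v, 0) 7.
have lit_excl j v := @literal_excl S timelineS coverS j v.
have lit_cov j v := @literal_cover S coverS j v.
have lit_next j v := @literal_cover_next S coverS j v.
(* Inactivity at a time forces the neighbour to be active, which excludes the opposite time. Falsity
   passes from row [j] to row [j.+1] through the times 1, 8, 1, truth through the times 7 and 2. *)
have xS j v : j.+1 < J -> v < V -> x j.+1 v = x j v.
  move=> ltj ltv; have ltj' : j < J by lia.
  have c1 := lit_cov j v ltj' ltv 1 isT; have c7 := lit_cov j v ltj' ltv 7 isT.
  have d1 := lit_cov j.+1 v ltj ltv 1 isT.
  have d7 := lit_cov j.+1 v ltj ltv 7 isT.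
  have n2 := lit_next j v ltj' ltv 2 ltj isT.
  have n8 := lit_next j v ltj' ltv 8 ltj isT.
  have e := lit_excl j v ltj' ltv; have f := lit_excl j.+1 v ltj ltv.
  have e17 := e 0 1 7 isT isT isT; have e27 := e 1 2 7 isT isT isT.
  have e18 := e 1 1 8 isT isT isT.
  have f27 := f 0 2 7 isT isT isT; have f18 := f 0 1 8 isT isT isT.
  have f17 := f 1 1 7 isT isT isT.
  rewrite /x; apply/idP/idP => [n7|n7]; apply/negP=> a7.
    have a1 : act S (j, v, 1) 1.
      by move: c1; case: (act S (j, v, 0) 1) e17 => // /(_ isT); rewrite a7.
    move: n8; rewrite (negbTE (e18 a1)) /= => a8.
    have b1 : act S (j.+1, v, 1) 1.
      move: d1; case: (act S (j.+1, v, 0) 1) f18 => // /(_ isT).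
      by rewrite a8.
    by move: d7; rewrite (negbTE n7) (negbTE (f17 b1)).
  move: c7; rewrite (negbTE n7) /= => b7.
  have := n2; rewrite (contraTF e27 b7) /=.
  by move/f27; rewrite a7.
have x0 j v : j < J -> v < V -> x j v = x 0 v.
  by elim: j => // j IH ltj ltv; rewrite xS // IH //; lia.
exists (x 0) => j ltj.
suff [v ltv Av] : exists2 v, v < V & lit_true (A j v) (x j v).
  by exists v; rewrite // -(x0 j).
case: (pickP (fun v : 'I_V => lit_true (A j v) (x j v))) => [v|none].
  by exists v.
have {}none v : v < V -> lit_true (A j v) (x j v) = false.
  by move=> ltv; apply: (none (Ordinal ltv)).
have c_cover v g t : v < V -> g < 8 -> t < 23 ->
    partner3 t (j, v, 3) = Some (j, v, g) -> ~~ act S (j, v, g) t ->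
    act S (j, v, 3) t.
  move=> ltv lt8 lt23 E na; have := act_cover coverS lt23 _ E.
  by rewrite (negbTE na) orbF; apply; rewrite /= ltj ltv.
(* Whether the literal is absent or false, the neighbour at time 0 is inactive; [Tru] is excluded by
   [none]. *)
have c0 v : v < V -> act S (j, v, 3) 0.
  move=> ltv; have := none v ltv; rewrite /x.
  have [dead6 _] := clause_forcer_dead timelineS coverS ltj ltv (t := 0) isT.
  have e := lit_excl j v ltj ltv; have c := lit_cov j v ltj ltv 7 isT.
  case EA: (A j v) => //= nx.
  - by apply: (c_cover v 6); rewrite // /partner3 /= EA.
  - apply: (c_cover v 0); rewrite // /partner3 /= ?EA //.
    by apply/negP=> /e -/(_ 7 isT isT isT); rewrite nx.
  - apply: (c_cover v 1); rewrite // /partner3 /= ?EA //.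
    apply/negP=> /e -/(_ 7 isT isT isT) n7; move: c nx.
    by rewrite (negbTE n7) orbF negbK => ->.
have dead v t : v < V -> t \in [:: 0; 6; 12] -> ~~ act S (j, v, 6) t.
  by move=> ltv tP; case: (clause_forcer_dead timelineS coverS ltj ltv tP).
(* All prefix variables are false: a clause vertex active at 0 and 6 is not active at 12, so the
   next prefix vertex is, which excludes time 6 for it. *)
have n6 v : v < V -> 0 < v -> ~~ act S (j, v, 2) 6.
  have c6 v' : v' < V -> (0 < v' -> ~~ act S (j, v', 2) 6) -> act S (j, v', 3) 6.
    move=> ltv'; case: v' ltv' => [|v'] ltv' n6.
      by apply: (c_cover 0 6); rewrite // dead.
    by apply: (c_cover v'.+1 2); rewrite // n6.
  elim: v => // v IH ltv _; have ltv' : v < V by lia.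
  have a6 := c6 v ltv' (IH ltv').
  have n12 : ~~ act S (j, v, 3) 12.
    apply/negP=> a12.
    exact: (act_spread timelineS (x := (j, v, 3)) (t1 := 0) (t2 := 6) (t3 := 12)
             isT isT (c0 v ltv')).
  apply: (prefix_excl timelineS coverS ltj ltv).
  have ne : (v.+1 == V) = false by lia.
  have := act_cover coverS (t := 12) (x := (j, v, 3)) (y := (j, v.+1, 2)) isT.
  by rewrite (negbTE n12) /partner3 /= ltj ltv' ne; apply.
(* In the last column, the edge at time 12 leads to a forcer instead of a further prefix vertex. *)
pose v := V.-1; have ltv : v < V by rewrite /v; lia.
have a6 : act S (j, v, 3) 6.
  have [v0|v_gt0] := posnP v.
    by apply: (c_cover v 6); rewrite ?dead // /partner3 /= v0.
  apply: (c_cover v 2); rewrite ?n6 // /partner3 /=.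
  by rewrite -(prednK v_gt0).
have a12 : act S (j, v, 3) 12.
  apply: (c_cover v 6); rewrite ?dead // /partner3 /= /v prednK // eqxx //.
by case: (act_spread timelineS (x := (j, v, 3)) (t1 := 0) (t2 := 6) (t3 := 12)
           isT isT (c0 v ltv) a6 a12).
Qed.

(** * From a satisfying assignment to a covering timeline *)

Section Complete.
Variable sigma : nat -> bool.
Hypothesis sat : forall j, j < J -> exists2 v, v < V & lit_true (A j v) (sigma v).

Definition prefix_sat (j v : nat) : bool :=
  has (fun v => lit_true (A j v) (sigma v)) (iota 0 v).

(** Starts of two intervals of full length 4. The pairs 4, 5 and 6, 7 tile their 20 common times
    exactly. A clause vertex skips 0 if its literal is true, else 6 if the prefix is true, else
    12. *)
Definition starts (x : triple) : nat * nat :=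
  let: (j, v, g) := x in
  match g with
  | 0 => (if sigma v then 0 else 7, 18)
  | 1 => (if sigma v then 7 else 0, 18)
  | 2 => (0, if prefix_sat j v then 6 else 12)
  | 3 => if lit_true (A j v) (sigma v) then (6, 12)
         else if prefix_sat j v then (0, 12) else (0, 6)
  | 4 => (0, 5)
  | 5 => (10, 15)
  | 6 => (1, 7)
  | _ => (13, 18)
  end.

Definition on (x : triple) (t : nat) : bool :=
  ((starts x).1 <= t <= (starts x).1 + 4) || ((starts x).2 <= t <= (starts x).2 + 4).

Lemma starts_le x : ((starts x).1 <= 18) && ((starts x).2 <= 18).
Proof.
case: x => [[j v] g] /=.
case: g => [|[|[|[|[|[|[|[|g]]]]]]]] //=; do ?case: ifP => //.
Qed.

Lemma on_cover t x y : t < 23 -> in_range x -> partner3 t x = Some y ->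
  on x t || on y t.
Proof.
case: x => [[j v] g] lt23 /and3P[ltj ltv _]; rewrite /partner3 /slot_at.
have pS v' : prefix_sat j v'.+1 = prefix_sat j v' || lit_true (A j v') (sigma v').
  by rewrite /prefix_sat -addn1 iotaD has_cat /= orbF.
case Es: slot => [[s g']|] // [<-].
have := slotP lt23 Es; case: s Es => /= Es.
- move=> _; move: lt23 Es; rewrite /on.
  (* [pV] and [p0] are the facts for the last and first columns. They are generalized together with
     the border flags, so that each case receives its instance; satisfaction of the row enters only
     through [pV]. *)
  have pV : v.+1 == V -> prefix_sat j v || lit_true (A j v) (sigma v).
    move=> /eqP EV; rewrite -pS EV; have [v' ltv' Av'] := sat ltj.
    by apply/hasP; exists v'; rewrite ?mem_iota.
  have p0 : v == 0 -> prefix_sat j v = false by move=> /eqP ->.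
  case: g => [|[|[|[|[|[|[|[|g]]]]]]]] //; do 23?[case: t => [|t]];
  move=> // _; rewrite /slot /=; try discriminate;
  repeat match goal with
  | |- ?l = _ -> _ =>
    match l with context [match ?x with _ => _ end] =>
      lazymatch x with context [match _ with _ => _ end] => fail
      | _ => move: pV p0; case: x => pV p0 end end
  end; try discriminate; case=> <- /=;
  move: pV p0; case: (sigma v) => //=; case: (prefix_sat j v) => //= pV p0;
  by [| case: (A j v) pV => // /(_ isT) | move: (p0 isT)].
- case=> _ -> -> Et; rewrite /on /=.
  by case: Et => ->; case: (sigma v).
- case=> _ -> -> Et; rewrite /on /=.
  by case: Et => ->; case: (sigma v).
- case=> _ -> -> ->; rewrite /on /= pS.
  by case: lit_true; case: prefix_sat.
- case=> v0 -> -> ->; rewrite /on /=; case: v v0 {Es} ltv => // v _ ltv /=.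
  by rewrite pS; case: lit_true; case: prefix_sat.
Qed.

Arguments starts : simpl never.

Lemma start_lt1 x : (starts x).1 < 23.
Proof. by have := starts_le x; lia. Qed.
Lemma start_lt2 x : (starts x).2 < 23.
Proof. by have := starts_le x; lia. Qed.

Definition schedule : {set activity_interval 'I_gadget_order 23} :=
  [set I : activity_interval 'I_gadget_order 23 | (((I.1.2 : nat) == (starts (of_num I.1.1)).1) ||
            ((I.1.2 : nat) == (starts (of_num I.1.1)).2)) &&
           ((I.2 : nat) == I.1.2 + 4)].

Lemma schedule_active (u : 'I_gadget_order) (t : 'I_23) : on (of_num u) t -> active schedule u t.
Proof.
have := starts_le (of_num u) => /andP[le1 le2].
rewrite /on => /orP[ot|ot].
  exists (Ordinal (start_lt1 (of_num u))), (inord ((starts (of_num u)).1 + 4)).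
  by split; [rewrite inE /= inordK ?eqxx | rewrite /= inordK]; lia.
exists (Ordinal (start_lt2 (of_num u))), (inord ((starts (of_num u)).2 + 4)).
by split; [rewrite inE /= inordK ?eqxx ?orbT | rewrite /= inordK]; lia.
Qed.

Lemma schedule_timeline : is_timeline 2 4 schedule.
Proof.
split=> [u a b|u]; first by rewrite inE /= => /andP[_ /eqP ->]; lia.
pose iv s : activity_interval 'I_gadget_order 23 := (u, inord s, inord (s + 4)).
have sub : [set I in schedule | I.1.1 == u] \subset
    [set iv (starts (of_num u)).1; iv (starts (of_num u)).2].
  apply/subsetP=> -[[u' a] b]; rewrite !inE /= => /andP[/andP[Ea /eqP Eb] /eqP Eu].
  have Ei : (u', a, b) = iv a by rewrite /iv -Eb !inord_val Eu.
  by rewrite Ei -Eu; case/orP: Ea => /eqP ->; rewrite eqxx ?orbT.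
by apply: leq_trans (subset_leq_card sub) _; rewrite cards2; case: eqP.
Qed.

End Complete.

Lemma gadget_complete : cnf_sat J V A -> tvc_yes gadget.
Proof.
case=> sigma sat; exists (schedule sigma); split; first exact: schedule_timeline.
move=> t e; rewrite ffunE /= => /snapshot_edgesP[u [v [Euv _ ->]]].
move: Euv; rewrite /partner; case E: partner3 => [y|] //= [Ey].
have [ry _ _] := partner3_sym (ltn_ord t) (of_num_range (ltn_ord u)) E.
have := on_cover sat (ltn_ord t) (of_num_range (ltn_ord u)) E.
case/orP=> ot; [exists u | exists v]; rewrite ?set21 ?set22 //;
  apply: schedule_active => //.
by rewrite -Ey num_ofK.
Qed.

Lemma gadgetP : tvc_yes gadget <-> cnf_sat J V A.
Proof. by split; [apply: gadget_sound | apply: gadget_complete]. Qed.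

End Gadget.

(** * The computation tableau *)

(* The finite information on the clause at (t, p) and the variable at (t', p')
   from which [table] below computes an entry of the matrix. *)
Definition features (B : nat) (w : word) (t p t' p' : nat) : seq bool :=
  [:: t == 0; t.+1 == B; p == 0; p.+1 == B;
      t' == 0; t'.+1 == B; p' == 0; p'.+1 == B;
      t' == t; t' == t.+1; p' == p; p' == p.+1; p == p'.+1;
      p < size w; nth false w p].

Definition tableau_sat (B : nat) (w : word) (kind var : Type)
    (inkind : kind -> Prop) (invar : var -> Prop)
    (table : kind -> var -> seq bool -> entry) : Prop :=
  exists sigma : nat -> nat -> var -> bool, forall t p k,
    t < B -> p < B -> inkind k ->
    exists t' p' c, [/\ t' < B, p' < B & invar c] /\
      lit_true (table k c (features B w t p t' p')) (sigma t' p' c).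

(** * The clauses that describe a computation *)

Section Tableau.
Variable M : machine.

Local Notation tp := ('I_(ntapes M).+1).

Definition rule := (state M * {ffun tp -> symbol M} *
                    (state M * {ffun tp -> symbol M * move}))%type.

(* Variables at (t, p): the rule applied at time t (for p = 0; None once the
   machine has halted), or the symbol in cell p on the given side of a tape. *)
Definition tvar : finType := (option rule + tp * bool * symbol M)%type.

(* Clauses at (t, p): some rule is applied; two consecutive rules match; a rule
   reads the scanned symbols; cells evolve according to the rule; initial
   contents of a cell. *)
Definition tkind : finType :=
  option ((option rule * option rule) + (rule * tp * symbol M) +
          (rule * tp * bool * symbol M) + (tp * bool))%type.

(** [None] as a state means that the machine has halted: halting requires a final state and is
    permanent. *)
Definition fits (q : option (state M)) (d : option rule) : bool :=
  match q, d with
  | Some q, Some r => r.1.1 == q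
  | Some q, None => final q
  | None, Some _ => false
  | None, None => true
  end.

Definition next_state (d : option rule) : option (state M) :=
  omap (fun r : rule => r.2.1) d.

Definition applicable (d : option rule) : bool :=
  if d is Some r then ~~ final r.1.1 && (r.2 \in trans r.1.1 r.1.2) else true.

Variant dir := Same | Up | Down.

(** Where a cell is found after a move of the head, as a side and a change of position. [p0] tells
    whether the cell is the first on its side, which is where cells change sides. *)
Definition dest (mv : move) (side p0 : bool) : bool * dir :=
  match mv, side with
  | Stay, _ => (side, Same)
  | MoveRight, true => if p0 then (false, Same) else (true, Down)
  | MoveRight, false => (false, Up)
  | MoveLeft, true => (true, Up)
  | MoveLeft, false => if p0 then (true, Same) else (false, Down)
  end.

Definition dir_pos (d : dir) (p : nat) : nat :=
  match d with Same => p | Up => p.+1 | Down => p.-1 end.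

(* side = true indexes the head cell and the cells to its right from 0, and
   side = false the cells to its left: all tapes are seen from their heads. *)
Definition cell (T : Type) (b : T) (t : tape T) (side : bool) (p : nat) : T :=
  if side then nth b (tape_head t :: tape_right t) p else nth b (tape_left t) p.

Definition carried (T : Type) (x s : T) (side p0 : bool) : T :=
  if side && p0 then x else s.

Lemma cell_act (T : Type) (b : T) (t : tape T) (x : T) mv side p :
  cell b (tape_act b t (x, mv)) (dest mv side (p == 0)).1
    (dir_pos (dest mv side (p == 0)).2 p) =
  carried x (cell b t side p) side (p == 0).
Proof.
case: t => l h r; rewrite /cell /tape_act /carried /=.
by case: mv; case: side; case: p => [|[|p]]; case: l => [|? l]; case: r => [|? r];
  rewrite /= ?nth_nil.
Qed.

(** Each cell after a move comes from a cell at most one position farther out, so what is known up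
    to position [p.+1] determines the contents up to [p] one step later. *)
Lemma cell_source mv side p : exists side' p',
  [/\ p' <= p.+1, (dest mv side' (p' == 0)).1 = side
    & dir_pos (dest mv side' (p' == 0)).2 p' = p].
Proof.
case: mv; case: side; case: p => [|p].
- by exists false, 0.
- by exists true, p; split=> //; lia.
- by exists false, 1.
- by exists false, p.+2.
- by exists true, 0.
- by exists true, p.+1.
- by exists false, 0.
- by exists false, p.+1.
- by exists true, 1.
- by exists true, p.+2.
- by exists true, 0.
- by exists false, p; split=> //; lia.
Qed.

Definition neg_if (b : bool) : entry := if b then Neg else Zero.
Definition pos_if (b : bool) : entry := if b then Pos else Zero.

Definition dir_test (f : seq bool) (d : dir) : bool :=
  match d with
  | Same => nth false f 10
  | Up => nth false f 11
  | Down => nth false f 12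
  end.

(** Every kind of clause owns a row at every time and position, so a row with nothing to say there
    is filled with [Tru]. The other rows are disjunctions of admissible choices or implications,
    with [Neg] at the premises and [Pos] at the conclusion, if there is one. *)
Definition table (k : tkind) (c : tvar) (f : seq bool) : entry :=
  let t0 := nth false f 0 in let tl := nth false f 1 in
  let p0 := nth false f 2 in let pl := nth false f 3 in
  let p0' := nth false f 6 in
  let eqt := nth false f 8 in let eqtS := nth false f 9 in
  match k with
  | None =>
      if ~~ p0 then Tru else
      if c is inl d then
        pos_if [&& eqt, p0', applicable d, t0 ==> fits (Some (start M)) d
                 & tl ==> (d == None)]
      else Zero
  | Some (inl (inl (inl (d1, d2)))) =>
      if [|| fits (next_state d1) d2, ~~ p0 | tl] then Tru else
      if c is inl d then
        neg_if (p0' && (eqt && (d == d1) || eqtS && (d == d2)))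
      else Zero
  | Some (inl (inl (inr (r, i, s)))) =>
      if (r.1.2 i == s) || ~~ p0 then Tru else
      match c with
      | inl d => neg_if [&& p0', eqt & d == Some r]
      | inr x => neg_if [&& p0', eqt & x == (i, true, s)]
      end
  | Some (inl (inr (r, i, side, s))) =>
      let: (side', d') := dest (r.2.2 i).2 side p0 in
      if tl || pl then Tru else
      match c with
      | inl d => neg_if [&& p0', eqt & d == Some r]
      | inr x =>
          if eqt then neg_if (nth false f 10 && (x == (i, side, s)))
          else pos_if [&& eqtS, dir_test f d'
                        & x == (i, side', carried (r.2.2 i).1 s side p0)]
      end
  | Some (inr (i, side)) =>
      if ~~ t0 then Tru else
      if c is inr x then
        pos_if [&& eqt, nth false f 10
          & x == (i, side,
                  if [&& side, i == ord0 & nth false f 13]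
                  then letter M (nth false f 14) else blank M)]
      else Zero
  end.

(** * Accepting runs and satisfying assignments *)

Lemma reaches_rcons n (c c1 c2 : config M) :
  reaches n c c1 -> step c1 c2 -> reaches n.+1 c c2.
Proof.
elim: n c => [|n IH] c /=; first by move=> -> s12; exists c2.
by case=> c' sc r1 s12; exists c' => //; apply: IH.
Qed.

(** Turns a run into total functions of time, from which an assignment can be read off even at the
    times after halting. *)
Lemma reaches_trace n (c c' : config M) : reaches n c c' ->
  exists (cf : nat -> config M) (df : nat -> option rule),
  [/\ cf 0 = c, cf n = c', forall t, n <= t -> df t = None
    & forall t, t < n -> exists2 a, a \in trans (cstate (cf t)) (scanned (cf t))
      & [/\ ~~ final (cstate (cf t)),
            df t = Some (cstate (cf t), scanned (cf t), a)
          & cf t.+1 = Config a.1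
              [ffun i => tape_act (blank M) (ctapes (cf t) i) (a.2 i)]]].
Proof.
elim: n c => [|n IH] c /=; first by move=> ->; exists (fun=> c'), (fun=> None).
case=> c1 [nf [a aT Ec1]] /IH[cf [df [cf0 cfn dfn steps]]].
exists (fun t => if t is t'.+1 then cf t' else c).
exists (fun t => if t is t'.+1 then df t' else Some (cstate c, scanned c, a)).
split=> // [[|t]|[|t]] //; first exact: dfn.
  by move=> _; exists a; rewrite ?cf0.
exact: steps.
Qed.

Variable w : word.

Lemma cell_init i side p : cell (blank M) (ctapes (init M w) i) side p =
  if [&& side, i == ord0 & p < size w] then letter M (nth false w p) else blank M.
Proof.
rewrite /cell /init /= ffunE; case: side => /=; last by rewrite nth_nil.
case: eqP => _ /=; last by case: p => [|p] //; rewrite /= nth_nil.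
have -> : forall s : seq (symbol M),
    nth (blank M) (head (blank M) s :: behead s) p = nth (blank M) s p.
  by case=> //; case: p => //= p; rewrite nth_nil.
case: ltnP => lp; first by rewrite (nth_map false).
by rewrite nth_default ?size_map.
Qed.

Variable bound : nat.
Local Notation B := bound.+1.

(** Evolution clauses at the last position are vacuous, so some cells are not controlled; this
    ignorance approaches the head by one position per step. At time [t] the cells with
    [p + t < bound] are known, and these include the scanned ones before time [bound], when a halt
    is imposed. Only the presence of the right symbols is tracked: [read] makes the chosen rule
    agree with every symbol that holds in a scanned cell. *)
Lemma tableau_sound :
  tableau_sat B w (fun=> True) (fun=> True) table ->
  exists n (c : config M), [/\ n <= bound, reaches n (init M w) c & final (cstate c)].
Proof.
case=> sigma sat.
pose accepted t := exists n (c : config M),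
  [/\ n <= t, reaches n (init M w) c & final (cstate c)].
pose known t c := forall i side p, p + t < bound ->
  sigma t p (inr (i, side, cell (blank M) (ctapes c i) side p)).
pose inv t := accepted t \/ exists (c : config M) (d : option rule),
  [/\ reaches t (init M w) c, known t c,
      fits (Some (cstate c)) d && applicable d, sigma t 0 (inl d)
    & t = bound -> d = None].
have pick_rule t : t < B -> exists d, [/\ sigma t 0 (inl d), applicable d,
    t = 0 -> fits (Some (start M)) d & t = bound -> d = None].
  move=> lt; have [t' [p' [c [[lt' lp' _]]]]] := sat t 0 None lt isT I.
  case: c => [d|x] //=; rewrite /pos_if; case: ifP => //.
  case/and5P=> /eqP -> /eqP -> ad t0 tl sd; exists d; split=> // Et.
    by move: t0; rewrite Et.
  by move: tl; rewrite Et eqxx => /eqP.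
have compat t d1 d2 : t.+1 < B -> sigma t 0 (inl d1) -> sigma t.+1 0 (inl d2) ->
    fits (next_state d1) d2.
  move=> lt s1 s2; apply: contraT => nf.
  have lt' : t < B by lia.
  have [t' [p' [c [[_ _ _]]]]] :=
    sat t 0 (Some (inl (inl (inl (d1, d2))))) lt' isT I.
  rewrite /= (negbTE nf) /=; have -> : (t.+1 == B) = false by lia.
  case: c => [d|x] //=; rewrite /neg_if; case: ifP => //.
  case/andP=> /eqP -> /orP[] /andP[/eqP -> /eqP ->]; by rewrite ?s1 ?s2.
have read t r i s : t < B -> sigma t 0 (inl (Some r)) ->
    sigma t 0 (inr (i, true, s)) -> r.1.2 i = s.
  move=> lt s1 s2; apply/eqP; apply: contraT => ns.
  have [t' [p' [c [[_ _ _]]]]] :=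
    sat t 0 (Some (inl (inl (inr (r, i, s))))) lt isT I.
  rewrite /= (negbTE ns) /=.
  by case: c => [d|x]; rewrite /= /neg_if; case: ifP => //;
    case/and3P=> /eqP -> /eqP -> /eqP ->; rewrite ?s1 ?s2.
have move_cell t p r i side s : t.+1 < B -> p.+1 < B ->
    sigma t 0 (inl (Some r)) -> sigma t p (inr (i, side, s)) ->
    sigma t.+1 (dir_pos (dest (r.2.2 i).2 side (p == 0)).2 p)
      (inr (i, (dest (r.2.2 i).2 side (p == 0)).1,
            carried (r.2.2 i).1 s side (p == 0))).
  move=> lt lp s1 s2; have lt' : t < B by lia. have lp' : p < B by lia.
  have [t' [p' [c [[_ _ _]]]]] :=
    sat t p (Some (inl (inr (r, i, side, s)))) lt' lp' I.
  rewrite /=; have -> : (t.+1 == B) = false by lia.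
  have -> : (p.+1 == B) = false by lia.
  (* [Down] never occurs at position 0, so the predecessor in [dir_pos] is exact and the test
     [p == p'.+1] identifies it. *)
  have Down_gt0 : (dest (r.2.2 i).2 side (p == 0)).2 = Down -> 0 < p.
    by case: (r.2.2 i).2; case: side {s2}; case: p {lp lp'}.
  case: dest Down_gt0 => side' d' /= Down_gt0.
  case: c => [d|x]; rewrite /=.
    by rewrite /neg_if; case: ifP => // /and3P[/eqP -> /eqP -> /eqP ->]; rewrite s1.
  case: eqP => [->|_].
    by rewrite /neg_if; case: ifP => // /andP[/eqP -> /eqP ->]; rewrite s2.
  rewrite /pos_if; case: ifP => // /and3P[/eqP -> dt /eqP ->].
  have -> // : p' = dir_pos d' p.
  by case: d' dt Down_gt0 => /= /eqP // -> _; lia.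
have invP t : t < B -> inv t.
  elim: t => [|t IH] lt.
    have [d [sd ad f0 dl]] := pick_rule 0 lt.
    right; exists (init M w), d; split=> //; last by rewrite ad f0.
    move=> i side p; rewrite addn0 => /ltnW; rewrite -ltnS => lp.
    have [t' [p' [c [[_ _ _]]]]] := sat 0 p (Some (inr (i, side))) isT lp I.
    case: c => [d'|x] //=; rewrite /pos_if; case: ifP => //.
    by case/and3P=> /eqP -> /eqP -> /eqP ->; rewrite cell_init.
  case: IH => [|[n [c [le r f]]]|[c [[r|] [rc kn /andP[fd ad] sd dl]]]]; first by lia.
  - by left; exists n, c; split=> //; lia.
  - have lt' : t < B by lia.
    have Es : scanned c = r.1.2.
      apply/ffunP => i; rewrite ffunE; apply/esym/(read t) => //.
      by apply: (kn i true 0); lia.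
    have [d' [sd' ad' _ dl']] := pick_rule t.+1 lt.
    have Eq : r.1.1 = cstate c by apply/eqP.
    move: ad => /andP[nf aT]; rewrite Eq -Es in nf aT.
    right; exists (Config r.2.1
      [ffun i => tape_act (blank M) (ctapes c i) (r.2.2 i)]), d'.
    split=> //; last by rewrite ad' (compat t (Some r)).
      by apply: reaches_rcons rc _; split=> //; exists r.2.
    move=> i side p lp.
    have [side' [p' [le <- <-]]] := cell_source (r.2.2 i).2 side p.
    rewrite /= ffunE; have := cell_act (blank M) (ctapes c i) (r.2.2 i).1
      (r.2.2 i).2 side' p'.
    rewrite -surjective_pairing => ->.
    by apply: move_cell => //; [lia | apply: kn; lia].
  by left; exists t, c; split=> //; lia.
case: (invP bound (ltnSn _)) => // -[c [d [rc _ /andP[fd _] _ /(_ erefl) Ed]]].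
by exists bound, c; split=> //; move: fd; rewrite Ed.
Qed.

Lemma tableau_complete n (c : config M) :
  n <= bound -> reaches n (init M w) c -> final (cstate c) ->
  tableau_sat B w (fun=> True) (fun=> True) table.
Proof.
move=> le /reaches_trace[cf [df [cf0 cfn dfn steps]]] fc.
exists (fun t p x => match x with
  | inl d => d == df t
  | inr (i, side, s) => s == cell (blank M) (ctapes (cf t) i) side p end).
have fitsS t : fits (next_state (df t)) (df t.+1).
  have [lt|ge] := ltnP t n; last by rewrite !dfn //; lia.
  have [a _ [_ -> Ec]] := steps t lt; rewrite /next_state /=.
  have [lt1|ge1] := ltnP t.+1 n; last first.
    have <- : cstate (cf t.+1) = a.1 by rewrite Ec.
    have En : n = t.+1 by lia.
    by rewrite dfn //= -En cfn.
  by have [a' _ [_ -> _]] := steps t.+1 lt1; rewrite /= Ec.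
move=> t p k lt lp _.
case: k => [[[[[d1 d2]|[[r i] s]]|[[[r i] side] s]]|[i side]]|].
- have [f2|nf] := boolP (fits (next_state d1) d2).
    (* Any variable is a witness for a row filled with [Tru]; here and below this arbitrary one is
       taken. *)
    by exists 0, 0, (inl None); rewrite /= f2.
  have [E1|n1] := eqVneq d1 (df t); last first.
    exists t, 0, (inl d1); split=> //=; rewrite !eqxx /=.
    by case: ifP => //= _; rewrite n1.
  have [tl|lt1] := eqVneq t bound.
    by exists 0, 0, (inl None); rewrite /= tl eqxx !orbT.
  exists t.+1, 0, (inl d2); split=> /=; first by split=> //; lia.
  rewrite !eqxx /= orbT; case: ifP => //= _.
  by apply: contra nf => /eqP ->; rewrite E1.
- have [Es|ns] := eqVneq (r.1.2 i) s.
    by exists 0, 0, (inl None); rewrite /= Es eqxx.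
  have [Er|nr] := eqVneq (df t) (Some r); last first.
    exists t, 0, (inl (Some r)); split=> //=; rewrite !eqxx.
    by case: ifP => //= _; rewrite eq_sym.
  exists t, 0, (inr (i, true, s)); split=> //=; rewrite !eqxx.
  case: ifP => //= _; have [ltn|gen] := ltnP t n; last by move: Er; rewrite dfn.
  have [a _ [_ Ed _]] := steps t ltn; move: Er; rewrite Ed => -[Er].
  by move: ns; rewrite -Er ffunE eq_sym.
- have [tl|ntl] := eqVneq t bound.
    exists 0, 0, (inl None); split=> //=.
    by case: dest => ? ?; rewrite tl eqxx.
  have [pl|npl] := eqVneq p bound.
    exists 0, 0, (inl None); split=> //=.
    by case: dest => ? ?; rewrite pl eqxx orbT.
  have [Er|nr] := eqVneq (df t) (Some r); last first.
    exists t, 0, (inl (Some r)); split=> //=; rewrite !eqxx.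
    by case: dest => ? ?; case: ifP => //= _; rewrite eq_sym.
  have [Es|ns] := eqVneq s (cell (blank M) (ctapes (cf t) i) side p); last first.
    exists t, p, (inr (i, side, s)); split=> //=; rewrite !eqxx.
    by case: dest => ? ?; case: ifP.
  have [ltn|gen] := ltnP t n; last by move: Er; rewrite dfn.
  have [a _ [_ Ed Ec]] := steps t ltn; move: Er; rewrite Ed => -[Er].
  have := cell_act (blank M) (ctapes (cf t) i) (r.2.2 i).1 (r.2.2 i).2 side p.
  rewrite -surjective_pairing.
  have Down_gt0 : (dest (r.2.2 i).2 side (p == 0)).2 = Down -> 0 < p.
    by case: (r.2.2 i).2; case: side {Es}; case: p {lp npl}.
  case Ed': dest Down_gt0 => [side' d'] /= Down_gt0 Ecell.
  exists t.+1, (dir_pos d' p),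
    (inr (i, side', carried (r.2.2 i).1 s side (p == 0))).
  split; first by split=> //; [|case: d' {Ed' Down_gt0 Ecell}]; rewrite /=; lia.
  rewrite /= Ed' /=; have -> : (t.+1 == t) = false by lia.
  case: ifP => // _; have -> : dir_test (features B w t p t.+1 (dir_pos d' p)) d'.
    by case: d' {Ed' Ecell} Down_gt0 => //= /(_ erefl); lia.
  by rewrite !eqxx /= Ec /= ffunE Es -Ecell -Er.
- have [t0|nt0] := eqVneq t 0; last by exists 0, 0, (inl None); rewrite /= nt0.
  exists 0, p, (inr (i, side, cell (blank M) (ctapes (cf 0) i) side p)).
  by rewrite /= t0 !eqxx cf0 cell_init eqxx.
have [p0|np0] := eqVneq p 0; last by exists 0, 0, (inl None); rewrite /= np0.
exists t, 0, (inl (df t)); split=> //=; rewrite p0 !eqxx /=.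
have -> : applicable (df t).
  have [ltn|gen] := ltnP t n; last by rewrite dfn.
  by have [a aT [nf -> _]] := steps t ltn; rewrite /= nf.
have -> /= : (t == 0) ==> fits (Some (start M)) (df t).
  apply/implyP => /eqP ->; have [n0|n_gt0] := posnP n.
    by rewrite dfn ?n0 //= -[start M]/(cstate (init M w)) -cf0 -{1}n0 cfn.
  by have [a _ [_ -> _]] := steps 0 n_gt0; rewrite /= cf0.
by have -> : (t.+1 == B) ==> (df t == None);
  first by apply/implyP => /eqP[->]; rewrite dfn.
Qed.

End Tableau.

(** Clause kinds and variables are replaced by their indices in finite enumerations. What remains of
    the machine is two constants and a table that do not depend on [w], so that they can be built
    into a program. *)
Theorem cook_levin (L : language) : NP L ->
  exists (a d K1 K2 : nat) (tbl : nat -> nat -> seq bool -> entry),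
  [/\ 0 < K1, 0 < K2 & forall w, L w <->
    tableau_sat (a * size w ^ d + a).+1 w (fun k => k < K1) (fun c => c < K2) tbl].
Proof.
case=> M [a [d ML]].
exists a, d, (size (enum (tkind M))), (size (enum (tvar M))).
exists (fun k c => table (nth None (enum (tkind M)) k)
                         (nth (inl None) (enum (tvar M)) c)).
have size_gt0 (T : finType) (x : T) : 0 < size (enum T).
  by rewrite lt0n size_eq0; apply/eqP=> E; have := mem_enum T x; rewrite E.
split; [exact: size_gt0 None | exact: size_gt0 (inl None) |] => w.
apply: (iff_trans (ML w)); split.
  case=> n [c [le rc fc]]; have [sigma sat] := tableau_complete le rc fc.
  exists (fun t p c => sigma t p (nth (inl None) (enum (tvar M)) c)) => t p k lt lp _.
  have [t' [p' [x [[lt' lp' _] tx]]]] :=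
    sat t p (nth None (enum (tkind M)) k) lt lp I.
  exists t', p', (index x (enum (tvar M))).
  by split; [split; rewrite // index_mem mem_enum | rewrite nth_index ?mem_enum].
case=> sigma sat; apply: tableau_sound.
exists (fun t p x => sigma t p (index x (enum (tvar M)))) => t p k lt lp _.
have ltk : index k (enum (tkind M)) < size (enum (tkind M)).
  by rewrite index_mem mem_enum.
have [t' [p' [c [[lt' lp' ltc] tc]]]] := sat t p _ lt lp ltk.
exists t', p', (nth (inl None) (enum (tvar M)) c); split=> //.
by rewrite index_uniq ?enum_uniq //; move: tc; rewrite nth_index ?mem_enum.
Qed.

(** * Numbering the clauses and variables of the tableau *)

Lemma mixed_radixK (B K t p k : nat) : p < B -> k < K ->
  let j := (t * B + p) * K + k in
  [/\ j %% K = k, j %/ K %% B = p & j %/ K %/ B = t].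
Proof.
move=> ltp ltk /=; have K_gt0 : 0 < K by lia. have B_gt0 : 0 < B by lia.
by rewrite modnMDl divnMDl // (divn_small ltk) addn0 modnMDl divnMDl //
  (divn_small ltp) addn0 !modn_small.
Qed.

Lemma mixed_radix_lt (B K t p k : nat) : t < B -> p < B -> k < K ->
  (t * B + p) * K + k < B * B * K.
Proof.
move=> ltt ltp ltk.
have : (t * B + p).+1 <= B * B.
  apply: (@leq_trans (t.+1 * B)); first by lia.
  by rewrite leq_mul2r ltt orbT.
by rewrite -(leq_pmul2r (_ : 0 < K)) ?mulSn; lia.
Qed.

Lemma mixed_radix_digits (B K j : nat) : 0 < B -> 0 < K -> j < B * B * K ->
  [/\ j %/ K %/ B < B, j %/ K %% B < B & j %% K < K].
Proof.
move=> B_gt0 K_gt0 ltj; rewrite !ltn_mod; split=> //.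
by rewrite !ltn_divLR.
Qed.

Definition tableau_cnf (B : nat) (w : word) (K1 K2 : nat)
    (tbl : nat -> nat -> seq bool -> entry) (j v : nat) : entry :=
  tbl (j %% K1) (v %% K2)
    (features B w (j %/ K1 %/ B) (j %/ K1 %% B) (v %/ K2 %/ B) (v %/ K2 %% B)).

Lemma tableau_cnfP B w K1 K2 tbl : 0 < B -> 0 < K1 -> 0 < K2 ->
  tableau_sat B w (fun k => k < K1) (fun c => c < K2) tbl <->
  cnf_sat (B * B * K1) (B * B * K2) (tableau_cnf B w K1 K2 tbl).
Proof.
move=> B_gt0 K1_gt0 K2_gt0; split=> [] [sigma sat].
  exists (fun v => sigma (v %/ K2 %/ B) (v %/ K2 %% B) (v %% K2)) => j ltj.
  have [ltt ltp ltk] := mixed_radix_digits B_gt0 K1_gt0 ltj.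
  have [t' [p' [c [[lt' lp' ltc] tc]]]] := sat _ _ _ ltt ltp ltk.
  exists ((t' * B + p') * K2 + c); first exact: mixed_radix_lt.
  by rewrite /tableau_cnf; have [-> -> ->] := mixed_radixK t' lp' ltc.
exists (fun t p c => sigma ((t * B + p) * K2 + c)) => t p k ltt ltp ltk.
have [v ltv tv] := sat _ (mixed_radix_lt ltt ltp ltk).
exists (v %/ K2 %/ B), (v %/ K2 %% B), (v %% K2).
split; first by have [? ? ?] := mixed_radix_digits B_gt0 K2_gt0 ltv.
move: tv; rewrite /tableau_cnf -!divn_eq.
by have [-> -> ->] := mixed_radixK t ltp ltk.
Qed.

(** * Counter programs and their Turing machines *)

Variant cond := NonZero of nat | InNonblank | InOne.

Inductive cmd :=
  | Skip | Inc of nat | Dec of nat | Emit of bool | InL | InR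
  | Seq of cmd & cmd | If of cond & cmd & cmd | While of cond & cmd.

Lemma cond_comparable : comparable cond.
Proof. by move=> x y; rewrite /decidable; decide equality; apply: eq_comparable. Qed.

Lemma cmd_comparable : comparable cmd.
Proof.
move=> x y; rewrite /decidable; decide equality;
  by [apply: eq_comparable | apply: cond_comparable].
Qed.
HB.instance Definition _ := hasDecEq.Build cmd (compareP cmd_comparable).

Record store := Store { regs : seq nat; ipos : nat; outp : word }.

Section Semantics.
Variable w : word.

Definition test (q : cond) (s : store) : bool :=
  match q with
  | NonZero r => nth 0 (regs s) r != 0
  | InNonblank => ipos s < size w
  | InOne => nth false w (ipos s)
  end.

Definition control (b : bool) (k : seq cmd) : seq cmd :=
  if k is c :: k then
    match c with
    | Seq c1 c2 => c1 :: c2 :: k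
    | If _ c1 c2 => if b then c1 :: k else c2 :: k
    | While _ c1 => if b then c1 :: c :: k else k
    | _ => k
    end
  else [::].

Definition guard (k : seq cmd) (s : store) : bool :=
  match k with If q _ _ :: _ | While q _ :: _ => test q s | _ => false end.

(* A command is stuck when the machine below could not follow it. *)
Definition stuck (c : cmd) (s : store) : bool :=
  match c with
  | Inc r | Dec r => size (regs s) <= r
  | InL => ipos s == 0
  | _ => false
  end.

Definition update (c : cmd) (s : store) : store :=
  let: Store rs i o := s in
  match c with
  | Inc r => Store (set_nth 0 rs r (nth 0 rs r).+1) i o
  | Dec r => Store (set_nth 0 rs r (nth 0 rs r).-1) i o
  | Emit b => Store rs i (rcons o b)
  | InL => Store rs i.-1 o
  | InR => Store rs i.+1 o
  | _ => s
  end.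

Definition next (ks : seq cmd * store) : seq cmd * store :=
  let: (k, s) := ks in
  if k is c :: _ then
    if stuck c s then ks else (control (guard k s) k, update c s)
  else ks.

(** The quantification over [k] makes runs compose. As [next] is the identity on a stuck command,
    such a run also certifies that no command met on the way is stuck. *)
Definition runs (c : cmd) (s s' : store) (T : nat) : Prop :=
  exists2 n, n <= T & forall k, iter n next (c :: k, s) = (k, s').

End Semantics.

(* The continuations that can occur while running [c] before [k]. *)
Fixpoint conts (c : cmd) (k : seq cmd) : seq (seq cmd) :=
  (c :: k) :: match c with
  | Seq c1 c2 => conts c1 (c2 :: k) ++ conts c2 k
  | If _ c1 c2 => conts c1 k ++ conts c2 k
  | While _ c1 => conts c1 (c :: k)
  | _ => [::]
  end.

Lemma conts_self c k : (c :: k) \in conts c k.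
Proof. by case: c => *; rewrite /= inE eqxx. Qed.

(** The finite list [conts c k] is closed under execution until [k] is reached, so continuations can
    serve as states of a machine. *)
Lemma conts_control b c k x :
  x \in conts c k -> control b x \in k :: conts c k.
Proof.
have cs := conts_self.
elim: c k x => [|r|r|e|||c1 IH1 c2 IH2|q c1 IH1 c2 IH2|q c1 IH1] k x;
  rewrite /= inE; try by rewrite ?orbF => /eqP ->; rewrite /= mem_head.
- case/predU1P=> [->|]; first by rewrite /= !inE mem_cat cs !orbT.
  rewrite mem_cat => /orP[/IH1|/IH2]; rewrite !inE mem_cat.
    by case/predU1P=> [->|->]; rewrite ?cs !orbT.
  by case/predU1P=> [->|->]; rewrite ?eqxx ?orbT.
- case/predU1P=> [->|].
    by case: (b); rewrite /= !inE mem_cat cs !orbT.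
  rewrite mem_cat => /orP[/IH1|/IH2]; rewrite !inE mem_cat;
  by case/predU1P=> [->|->]; rewrite ?eqxx ?orbT.
case/predU1P=> [->|/IH1]; first by case: (b); rewrite /= !inE ?cs ?eqxx ?orbT.
by rewrite !inE => /predU1P[->|->]; rewrite ?eqxx ?orbT.
Qed.

(** * Compilation to a deterministic multitape machine *)

Section Compiler.
Variables (K : nat) (main : cmd).

Definition code : seq (seq cmd) := [::] :: conts main [::].
(** The added state [None] is the start state, in which the counter tapes receive their end
    marks. *)
Definition cstates : finType := option (adhoc_seq_sub_finType code).
Definition pc (k : seq cmd) : cstates := insub k.

Local Notation sym := (option bool).
Local Notation tp := ('I_K.+2).

Definition mark : sym := Some true.

Definition tape_test (q : cond) (h : {ffun tp -> sym}) : bool :=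
  match q with
  | NonZero r => (r < K) && (h (inord r.+1) != mark)
  | InNonblank => h ord0 != None
  | InOne => h ord0 == Some true
  end.

Definition tape_guard (k : seq cmd) (h : {ffun tp -> sym}) : bool :=
  match k with If q _ _ :: _ | While q _ :: _ => tape_test q h | _ => false end.

(** Tape 0 is the input, the last tape the output, and register [r] lives on tape [r.+1], its value
    being the distance of the head from the end mark. A decrement on the mark stays put, in
    agreement with [.-1]. *)
Definition tape_action (k : seq cmd) (h : {ffun tp -> sym}) (i : tp) : sym * move :=
  match k with
  | Inc r :: _ => (h i, if i == r.+1 :> nat then MoveRight else Stay)
  | Dec r :: _ =>
      (h i, if (i == r.+1 :> nat) && (h i != mark) then MoveLeft else Stay)
  | Emit b :: _ => if i == ord_max then (Some b, MoveRight) else (h i, Stay)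
  | InL :: _ => (h i, if i == ord0 then MoveLeft else Stay)
  | InR :: _ => (h i, if i == ord0 then MoveRight else Stay)
  | _ => (h i, Stay)
  end.

Definition mark_counters (h : {ffun tp -> sym}) (i : tp) : sym * move :=
  (if 0 < i <= K then mark else h i, Stay).

Definition compiled_trans (q : cstates) (h : {ffun tp -> sym}) :
    {set cstates * {ffun tp -> sym * move}} :=
  [set if q is Some x
       then (pc (control (tape_guard (ssval x) h) (ssval x)),
             finfun (tape_action (ssval x) h))
       else (pc [:: main], finfun (mark_counters h))].

Definition compiled_final (q : cstates) : bool :=
  if q is Some x then ssval x == [::] else false.

Lemma Some_bool_inj : injective (@Some bool).
Proof. by move=> x y []. Qed.

Definition compiled : machine :=
  @Machine K.+1 cstates sym None Some Some_bool_inj (fun=> isT) None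
    compiled_final compiled_trans.

Lemma compiled_deterministic : deterministic compiled.
Proof. by move=> q s; rewrite cards1. Qed.

Lemma pc_code k : k \in code -> exists2 x, pc k = Some x & ssval x = k.
Proof. by move=> kc; rewrite /pc insubT; exists (SeqSub kc). Qed.

(* Cells left of [f 0] never matter. *)
Definition tape_rep (f : nat -> sym) (p : nat) (t : tape sym) : Prop :=
  [/\ tape_head t = f p, forall i, nth None (tape_right t) i = f (p + i.+1)
    & forall i, i < p -> nth None (tape_left t) i = f (p - i.+1)].

Lemma tape_rep_right f p t :
  tape_rep f p t -> tape_rep f p.+1 (tape_act None t (tape_head t, MoveRight)).
Proof.
case: t => l h r [/= Eh Er El]; split=> [|i|[|i] lti] /=.
- by rewrite -nth0 Er addn1.
- by rewrite nth_behead Er addnS addSn.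
- by rewrite Eh subn1.
by rewrite El.
Qed.

Lemma tape_rep_left f p t : tape_rep f p.+1 t ->
  tape_rep f p (tape_act None t (tape_head t, MoveLeft)).
Proof.
case: t => l h r [/= Eh Er El]; split=> [|[|i]|i lti] /=.
- by rewrite -nth0 El // subn1.
- by rewrite Eh addn1.
- by rewrite Er addSnnS.
by rewrite nth_behead El.
Qed.

Variable w : word.

Definition input_cell (p : nat) : sym := nth None (map Some w) p.
Definition counter_cell (p : nat) : sym := if p == 0 then mark else None.

Record rep (s : store) (ts : {ffun tp -> tape sym}) : Prop := Rep {
  rep_size : size (regs s) = K;
  rep_in : tape_rep input_cell (ipos s) (ts ord0);
  rep_reg : forall i : tp, 0 < i <= K ->
    tape_rep counter_cell (nth 0 (regs s) i.-1) (ts i);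
  rep_out : ts ord_max = Tape (rev (map Some (outp s))) None [::]
}.

Lemma input_cellE p : (input_cell p != None) = (p < size w) /\
  (input_cell p == Some true) = nth false w p.
Proof.
rewrite /input_cell; case: ltnP => lp.
  by rewrite (nth_map false) //; case: nth.
by rewrite !nth_default ?size_map.
Qed.

Lemma rep_guard k s ts : rep s ts ->
  tape_guard k [ffun i => tape_head (ts i)] = guard w k s.
Proof.
case: s => rs ip o [/= sz [hin _ _] hreg _].
have testE q : tape_test q [ffun i => tape_head (ts i)] = test w q (Store rs ip o).
  case: q => [r||] /=; rewrite ?ffunE ?hin; try by case: (input_cellE ip).
  have [ltr|ger] /= := ltnP; last by rewrite nth_default // sz.
  have E : (inord r.+1 : tp) = r.+1 :> nat by rewrite inordK; lia.
  have := hreg (inord r.+1); rewrite E => /(_ ltr)[-> _ _].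
  by rewrite /counter_cell /=; case: nth.
by case: k => [|[] *]; rewrite //= testE.
Qed.

Lemma rep_update c k s ts : rep s ts -> ~~ stuck c s ->
  rep (update c s) [ffun i => tape_act None (ts i)
    (tape_action (c :: k) [ffun i => tape_head (ts i)] i)].
Proof.
case: s => rs ip o [/= sz hin hreg hout].
have stay (i : tp) : tape_act None (ts i) (tape_head (ts i), Stay) = ts i.
  by case: (ts i).
have ne_max (i : tp) : 0 < i <= K -> (i == ord_max) = false.
  by move=> /andP[_ le]; rewrite -val_eqE /=; lia.
have ne_0 (i : tp) : 0 < i <= K -> (i == ord0) = false.
  by move=> /andP[gt _]; rewrite -val_eqE /=; lia.
have max0 : (ord0 == ord_max :> tp) = false by [].
case: c => [|r|r|b|||c1 c2|q c1 c2|q c1] /=.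
all: try by move=> _; split=> //= [|i iP|]; rewrite !ffunE stay //; apply: hreg.
- rewrite -ltnNge sz => ltr; split=> //=; rewrite ?size_set_nth ?sz.
  + by apply/maxn_idPr.
  + by rewrite !ffunE stay.
  + move=> i iP; rewrite !ffunE nth_set_nth /=; have := hreg i iP.
    have -> : (i.-1 == r) = (i == r.+1 :> nat) by lia.
    case: eqP => [->|_]; first exact: tape_rep_right.
    by rewrite stay.
  + by rewrite !ffunE /= (_ : (K.+1 == r.+1) = false) ?stay //; lia.
- rewrite -ltnNge sz => ltr; split=> //=; rewrite ?size_set_nth ?sz.
  + by apply/maxn_idPr.
  + by rewrite !ffunE stay.
  + move=> i iP; rewrite !ffunE nth_set_nth /=; have := hreg i iP.
    have -> : (i.-1 == r) = (i == r.+1 :> nat) by lia.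
    case: eqP => [->|_]; last by rewrite stay.
    rewrite /= => hi; have [Eh _ _] := hi; rewrite Eh /counter_cell.
    case: (nth 0 rs r) hi Eh => [|v] hi Eh /=; last first.
      by move: (tape_rep_left hi); rewrite Eh.
    by have := stay i; rewrite Eh => ->.
  + by rewrite !ffunE /= (_ : (K.+1 == r.+1) = false) ?stay //; lia.
- move=> _; split=> //= [|i iP|]; first by rewrite !ffunE max0 stay.
    by rewrite !ffunE ne_max // stay; apply: hreg.
  by rewrite !ffunE eqxx hout /= map_rcons rev_rcons.
- move=> ip0; split=> //= [|i iP|]; last by rewrite !ffunE eq_sym max0 stay.
    by rewrite !ffunE eqxx; apply: tape_rep_left; rewrite prednK ?lt0n.
  by rewrite !ffunE ne_0 // stay; apply: hreg.
move=> _; split=> //= [|i iP|]; last by rewrite !ffunE eq_sym max0 stay.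
  by rewrite !ffunE eqxx; apply: tape_rep_right.
by rewrite !ffunE ne_0 // stay; apply: hreg.
Qed.

(** Where the abstract configuration is left unchanged, on a stuck command or an empty list, the
    machine makes no step; hence [m <= n] rather than equality. *)
Lemma compiled_run n k s s' ts : k \in code -> rep s ts ->
  iter n (next w) (k, s) = ([::], s') ->
  exists m (c : config compiled), [/\ m <= n,
    reaches m (@Config compiled (pc k) ts) c, final (cstate c)
    & ctapes c ord_max = Tape (rev (map Some (outp s'))) None [::]].
Proof.
elim: n k s ts => [|n IH] k s ts kc rs.
  move=> /= [Ek <-]; exists 0, (@Config compiled (pc k) ts); split=> //=.
    by have [x -> /= ->] := pc_code kc; rewrite Ek.
  exact: rep_out rs.
rewrite iterSr; case: k kc => [|c k] kc.
  move=> /= E; have [m [c' [le r f o]]] := IH _ _ _ kc rs E.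
  by exists m, c'; split=> //; lia.
rewrite [next w _]/=; case: ifPn => [st|nst].
  move=> E; have [m [c' [le r f o]]] := IH _ _ _ kc rs E.
  by exists m, c'; split=> //; lia.
move=> E; have kc' : control (guard w (c :: k) s) (c :: k) \in code.
  by move: kc; rewrite inE /= => /conts_control; apply.
have [m [c' [le r f o]]] := IH _ _ _ kc' (rep_update k rs nst) E.
exists m.+1, c'; split=> //=.
exists (@Config compiled (pc (control (guard w (c :: k) s) (c :: k)))
  [ffun i => tape_act None (ts i)
    (tape_action (c :: k) [ffun i => tape_head (ts i)] i)]) => //.
have [x Ex Ev] := pc_code kc; split; first by rewrite /= Ex /= Ev.
exists (pc (control (guard w (c :: k) s) (c :: k)),
        finfun (tape_action (c :: k) [ffun i => tape_head (ts i)])).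
  have -> : scanned (@Config compiled (pc (c :: k)) ts) =
      [ffun i => tape_head (ts i)] by [].
  rewrite [trans _ _]/(compiled_trans (pc (c :: k)) [ffun i => tape_head (ts i)]).
  by rewrite /compiled_trans Ex Ev (rep_guard (c :: k) rs) set11.
by congr Config; apply/ffunP=> i; rewrite !ffunE.
Qed.

Lemma compiled_runs T s' : runs w main (Store (nseq K 0) 0 [::]) s' T ->
  exists m (c : config compiled), [/\ m <= T.+1,
    reaches m (init compiled w) c, final (cstate c) & output c (outp s')].
Proof.
case=> n le /(_ [::]) E.
pose ts : {ffun tp -> tape sym} := [ffun i => tape_act None
  (ctapes (init compiled w) i) (mark_counters (scanned (init compiled w)) i)].
have rts : rep (Store (nseq K 0) 0 [::]) ts.
  split=> /=; first by rewrite size_nseq.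
  - rewrite !ffunE /= /input_cell; split=> /= [|i|i //].
      by rewrite !ffunE /= nth0.
    by rewrite nth_behead.
  - move=> i iP; have ne0 : (i == ord0) = false by rewrite -val_eqE /=; lia.
    rewrite !ffunE ne0 /mark_counters iP nth_nseq if_same /=.
    by split=> // j; rewrite /= nth_nil.
  by rewrite !ffunE /= /mark_counters /= ltnn !ffunE.
have mc : [:: main] \in code by rewrite inE conts_self orbT.
have [m [c [lem rm fc oc]]] := compiled_run mc rts E.
exists m.+1, c; split=> //; first by lia.
  exists (@Config compiled (pc [:: main]) ts) => //; split=> //.
  exists (pc [:: main], finfun (mark_counters (scanned (init compiled w)))).
    exact: set11.
  by congr Config; apply/ffunP=> i; rewrite !ffunE.
(* The one trailing blank is the cell under the head. *)
exists 0, 1; rewrite /tape_cells oc /= revK.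
by [].
Qed.

End Compiler.

(** The additional step that writes the end marks is absorbed by passing from [a] to [a.+1]. *)
Lemma runs_poly_time (f : word -> word) (K : nat) (main : cmd) (a d : nat) :
  (forall w, exists2 s, outp s = f w &
    runs w main (Store (nseq K 0) 0 [::]) s (a * size w ^ d + a)) ->
  poly_time f.
Proof.
move=> H; exists (compiled K main), a.+1, d; split.
  exact: compiled_deterministic.
move=> w; have [s <- rs] := H w.
have [m [c [le rm fc oc]]] := compiled_runs rs.
by exists m, c; split=> //; apply: leq_trans le _; rewrite mulSn; lia.
Qed.

(** * Arithmetic on counters *)

Definition clear (x : nat) : cmd := While (NonZero x) (Dec x).

(** Reading a counter destroys it, so [y] is moved to the scratch register [z], assumed to be zero,
    and then back. *)
Definition add (x y z : nat) : cmd :=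
  Seq (While (NonZero y) (Seq (Dec y) (Seq (Inc x) (Inc z))))
      (While (NonZero z) (Seq (Dec z) (Inc y))).

Definition sub (x y z : nat) : cmd :=
  Seq (While (NonZero y) (Seq (Dec y) (Seq (Dec x) (Inc z))))
      (While (NonZero z) (Seq (Dec z) (Inc y))).

Definition mul (x y z l : nat) : cmd :=
  Seq (While (NonZero x) (Seq (Dec x) (Inc l)))
      (While (NonZero l) (Seq (Dec l) (add x y z))).

Definition seqs (cs : seq cmd) : cmd := foldr Seq Skip cs.

Definition emit_all (x : nat) (b : bool) : cmd :=
  While (NonZero x) (Seq (Dec x) (Emit b)).

Definition for_loop (i r : nat) (c : cmd) : cmd :=
  Seq (While (NonZero r) (Seq c (Seq (Dec r) (Inc i))))
      (While (NonZero i) (Seq (Dec i) (Inc r))).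

Lemma regs_eq (rs rs' : seq nat) : size rs = size rs' ->
  (forall k, nth 0 rs k = nth 0 rs' k) -> rs = rs'.
Proof. by move=> sz E; apply: (@eq_from_nth _ 0) => // k _; apply: E. Qed.

Lemma size_upd (rs : seq nat) x v : x < size rs -> size (set_nth 0 rs x v) = size rs.
Proof. by move=> lx; rewrite size_set_nth; apply/maxn_idPr. Qed.

Lemma nth_upd (rs : seq nat) x v k :
  nth 0 (set_nth 0 rs x v) k = if k == x then v else nth 0 rs k.
Proof. by rewrite nth_set_nth. Qed.

Ltac upd_cases := rewrite ?nth_upd;
  repeat match goal with |- context [if ?a == ?b then _ else _] =>
    let e := fresh "e" in case: (a =P b) => [e|e]; rewrite ?e //
  end; subst; try (exfalso; lia); try lia.

Ltac upd_eq := apply: regs_eq;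
  [by rewrite ?size_upd // ?size_upd // ?size_upd // ?size_upd // | intro; upd_cases].

Section Rules.
Variable w : word.
Local Notation runs := (runs w).
Local Notation upd rs x v := (set_nth 0 rs x v).

Lemma runs_le c s s' T T' : T <= T' -> runs c s s' T -> runs c s s' T'.
Proof. by move=> le [n len E]; exists n => //; lia. Qed.

Lemma runs_update c s : match c with
    | Seq _ _ | If _ _ _ | While _ _ => false | _ => ~~ stuck c s end ->
  runs c s (update c s) 1.
Proof. by case: c => //= *; exists 1 => //= k; case: ifP => //; lia. Qed.

Lemma runs_skip s : runs Skip s s 1.
Proof. by exists 1 => // k /=; case: s. Qed.

Lemma runs_seq c1 c2 s s1 s2 T1 T2 :
  runs c1 s s1 T1 -> runs c2 s1 s2 T2 -> runs (Seq c1 c2) s s2 (T1 + T2 + 1).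
Proof.
case=> n1 le1 E1 [n2 le2 E2]; exists (n2 + n1 + 1); first by lia.
move=> k; rewrite iterD iterD /=.
by have -> : update (Seq c1 c2) s = s; [case: (s) | rewrite E1 E2].
Qed.

Lemma runs_if q c1 c2 s s' T :
  runs (if test w q s then c1 else c2) s s' T -> runs (If q c1 c2) s s' T.+1.
Proof.
case=> n le E; exists n.+1 => // k; rewrite iterSr /=.
have -> : update (If q c1 c2) s = s by case: (s).
by case: ifP E => _ E; rewrite E.
Qed.

Lemma runs_while q c (S : nat -> store) n T :
  (forall i, i < n -> test w q (S i) /\ runs c (S i) (S i.+1) T) ->
  ~~ test w q (S n) -> runs (While q c) (S 0) (S n) (n * T.+1 + 1).
Proof.
move=> step stop; suff: forall m, m <= n ->
    runs (While q c) (S (n - m)) (S n) (m * T.+1 + 1).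
  by move=> /(_ n (leqnn n)); rewrite subnn.
elim=> [|m IH] lem.
  rewrite subn0; exists 1 => // k /=; rewrite (negbTE stop).
  by case: (S n).
have [tm [n1 le1 E1]] := step (n - m.+1) ltac:(lia).
have [n2 le2 E2] := IH (ltnW lem).
exists (n2 + n1 + 1); first by rewrite mulSn; lia.
move=> k; rewrite iterD iterD /= tm.
have -> : update (While q c) (S (n - m.+1)) = S (n - m.+1) by case: (S _).
by rewrite E1 subnSK // E2.
Qed.

Lemma upd_id rs x : x < size rs -> upd rs x (nth 0 rs x) = rs.
Proof. by move=> lx; upd_eq. Qed.

Lemma runs_inc rs i o x : x < size rs ->
  runs (Inc x) (Store rs i o) (Store (upd rs x (nth 0 rs x).+1) i o) 1.
Proof. by move=> lx; apply: (@runs_update (Inc x)); rewrite /= -ltnNge. Qed.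

Lemma runs_dec rs i o x : x < size rs ->
  runs (Dec x) (Store rs i o) (Store (upd rs x (nth 0 rs x).-1) i o) 1.
Proof. by move=> lx; apply: (@runs_update (Dec x)); rewrite /= -ltnNge. Qed.

Lemma runs_clear rs i o x : x < size rs ->
  runs (clear x) (Store rs i o) (Store (upd rs x 0) i o) (nth 0 rs x * 2 + 1).
Proof.
move=> lx; pose v := nth 0 rs x.
have := @runs_while (NonZero x) (Dec x) (fun k => Store (upd rs x (v - k)) i o) v 1.
rewrite subnn subn0 upd_id //; apply=> [k ltk|]; last by rewrite /= nth_set_nth /= eqxx.
split; first by rewrite /= nth_set_nth /= eqxx; lia.
have := @runs_dec (upd rs x (v - k)) i o x; rewrite size_upd // => /(_ lx).
by rewrite nth_set_nth /= eqxx set_set_nth eqxx -subnS.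
Qed.

Definition counts (n : nat) (c : cmd) : bool :=
  match c with Inc r | Dec r => r < n | _ => false end.

Lemma runs_counts c s : counts (size (regs s)) c -> runs c s (update c s) 1.
Proof. by move=> cc; apply: runs_update; case: c cc => //= *; rewrite -ltnNge. Qed.

Lemma size_update c s : counts (size (regs s)) c ->
  size (regs (update c s)) = size (regs s).
Proof. by case: c => //; case: s => * /=; rewrite size_upd. Qed.

Lemma runs_counts2 c1 c2 s : counts (size (regs s)) c1 -> counts (size (regs s)) c2 ->
  runs (Seq c1 c2) s (update c2 (update c1 s)) 3.
Proof.
move=> h1 h2; apply: (@runs_seq _ _ _ _ _ 1 1 (runs_counts h1)).
by apply: runs_counts; rewrite size_update.
Qed.

Lemma runs_counts3 c1 c2 c3 s : counts (size (regs s)) c1 ->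
  counts (size (regs s)) c2 -> counts (size (regs s)) c3 ->
  runs (Seq c1 (Seq c2 c3)) s (update c3 (update c2 (update c1 s))) 5.
Proof.
move=> h1 h2 h3; apply: (@runs_seq _ _ _ _ _ 1 3 (runs_counts h1)).
by apply: runs_counts2; rewrite size_update.
Qed.

Section Transfer.
Variables (rs : seq nat) (i : nat) (o : word) (x y z : nat).
Hypotheses (lx : x < size rs) (ly : y < size rs) (lz : z < size rs).
Hypotheses (nxy : x != y) (nxz : x != z) (nyz : y != z) (z0 : nth 0 rs z = 0).

Lemma runs_move_back b v : nth 0 rs y = b ->
  runs (While (NonZero z) (Seq (Dec z) (Inc y)))
    (Store (upd (upd (upd rs y 0) x v) z b) i o)
    (Store (upd rs x v) i o) (b * 4 + 1).
Proof.
move=> yb.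
pose S k := Store (upd (upd (upd rs y k) x v) z (b - k)) i o.
have := @runs_while (NonZero z) (Seq (Dec z) (Inc y)) S b 3.
have -> : S b = Store (upd rs x v) i o by congr Store; upd_eq.
rewrite /S subn0; apply=> [k ltk|]; last by rewrite /=; upd_cases.
split; first by rewrite /=; upd_cases.
have := @runs_counts2 (Dec z) (Inc y)
  (Store (upd (upd (upd rs y k) x v) z (b - k)) i o).
rewrite /= !size_upd ?size_upd // => /(_ lz ly).
by congr runs; congr Store; upd_eq.
Qed.


Lemma runs_add : runs (add x y z) (Store rs i o)
  (Store (upd rs x (nth 0 rs x + nth 0 rs y)) i o) (10 * nth 0 rs y + 3).
Proof.
set a := nth 0 rs x; move Eb: (nth 0 rs y) => b.
pose S k := Store (upd (upd (upd rs y (b - k)) x (a + k)) z k) i o.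
apply: (@runs_le _ _ _ ((b * 6 + 1) + (b * 4 + 1) + 1)); first by lia.
apply: (@runs_seq _ _ _ (S b)); last by rewrite /S subnn; apply: runs_move_back.
have -> : Store rs i o = S 0 by congr Store; rewrite /a; upd_eq.
apply: runs_while => [k ltk|]; last by rewrite /=; upd_cases.
split; first by rewrite /=; upd_cases.
have := @runs_counts3 (Dec y) (Inc x) (Inc z) (S k).
rewrite /= !size_upd ?size_upd // => /(_ ly lx lz).
by congr runs; congr Store; upd_eq.
Qed.

Lemma runs_sub : runs (sub x y z) (Store rs i o)
  (Store (upd rs x (nth 0 rs x - nth 0 rs y)) i o) (10 * nth 0 rs y + 3).
Proof.
set a := nth 0 rs x; move Eb: (nth 0 rs y) => b.
pose S k := Store (upd (upd (upd rs y (b - k)) x (a - k)) z k) i o.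
apply: (@runs_le _ _ _ ((b * 6 + 1) + (b * 4 + 1) + 1)); first by lia.
apply: (@runs_seq _ _ _ (S b)); last by rewrite /S subnn; apply: runs_move_back.
have -> : Store rs i o = S 0 by congr Store; rewrite /a; upd_eq.
apply: runs_while => [k ltk|]; last by rewrite /=; upd_cases.
split; first by rewrite /=; upd_cases.
have := @runs_counts3 (Dec y) (Dec x) (Inc z) (S k).
rewrite /= !size_upd ?size_upd // => /(_ ly lx lz).
by congr runs; congr Store; upd_eq.
Qed.

End Transfer.

Lemma runs_mul rs i o x y z l : x < size rs -> y < size rs -> z < size rs ->
  l < size rs -> uniq [:: x; y; z; l] -> nth 0 rs z = 0 -> nth 0 rs l = 0 ->
  runs (mul x y z l) (Store rs i o)
    (Store (upd rs x (nth 0 rs x * nth 0 rs y)) i o)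
    (nth 0 rs x * (10 * nth 0 rs y + 10) + 3).
Proof.
move=> lx ly lz ll; rewrite /= !inE !negb_or andbT.
case/and3P=> /and3P[nxy nxz nxl] /andP[nyz nyl] nzl z0 l0.
move Ea: (nth 0 rs x) => a; move Eb: (nth 0 rs y) => b.
pose S k := Store (upd (upd rs x (a - k)) l k) i o.
pose S' k := Store (upd (upd rs x (k * b)) l (a - k)) i o.
apply: (@runs_le _ _ _ ((a * 4 + 1) + (a * (10 * b + 6) + 1) + 1)); first by nia.
apply: (@runs_seq _ _ _ (S a)).
  have -> : Store rs i o = S 0 by congr Store; upd_eq.
  apply: runs_while => [k ltk|]; last by rewrite /=; upd_cases.
  split; first by rewrite /=; upd_cases.
  have := @runs_counts2 (Dec x) (Inc l) (S k).
  rewrite /= !size_upd ?size_upd // => /(_ lx ll).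
  by congr runs; congr Store; upd_eq.
have -> : S a = S' 0 by rewrite /S /S' subnn subn0.
have -> : Store (upd rs x (a * b)) i o = S' a by congr Store; upd_eq.
rewrite (_ : 10 * b + 6 = (10 * b + 5).+1); last by lia.
apply: runs_while => [k ltk|]; last by rewrite /=; upd_cases.
split; first by rewrite /=; upd_cases.
rewrite (_ : 10 * b + 5 = 1 + (10 * b + 3) + 1); last by lia.
apply: runs_seq; first by apply: runs_counts; rewrite /= !size_upd ?size_upd.
have := @runs_add (regs (update (Dec l) (S' k))) i o x y z.
rewrite /= ?size_upd // ?size_upd // ?size_upd // => /(_ lx ly lz nxy nxz nyz).
have -> : nth 0 (upd (upd (upd rs x (k * b)) l (a - k)) l
    (nth 0 (upd (upd rs x (k * b)) l (a - k)) l).-1) y = b by upd_cases.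
have -> : nth 0 (upd (upd (upd rs x (k * b)) l (a - k)) l
    (nth 0 (upd (upd rs x (k * b)) l (a - k)) l).-1) z = 0 by upd_cases.
move=> /(_ erefl); congr runs; congr Store; upd_eq.
Qed.

Lemma runs_emit_all rs i o x b : x < size rs ->
  runs (emit_all x b) (Store rs i o)
    (Store (upd rs x 0) i (o ++ nseq (nth 0 rs x) b)) (nth 0 rs x * 4 + 1).
Proof.
move=> lx; move Ev: (nth 0 rs x) => v.
pose S k := Store (upd rs x (v - k)) i (o ++ nseq k b).
have -> : Store rs i o = S 0 by rewrite /S /= cats0; congr Store; upd_eq.
have -> : Store (upd rs x 0) i (o ++ nseq v b) = S v by rewrite /S subnn.
apply: runs_while => [k ltk|]; last by rewrite /=; upd_cases.
split; first by rewrite /=; upd_cases.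
apply: (@runs_seq _ _ _ (update (Dec x) (S k)) _ 1 1).
  by apply: runs_counts; rewrite /= size_upd.
have := @runs_update (Emit b) (update (Dec x) (S k)) isT.
congr runs; congr Store; first by upd_eq.
by rewrite rcons_cat -[RHS]/(o ++ nseq k.+1 b) -addn1 nseqD cats1.
Qed.

Lemma runs_seqs (I : Type) (r : seq I) (c : I -> cmd) (S : nat -> store) T :
  (forall k x0, k < size r -> runs (c (nth x0 r k)) (S k) (S k.+1) T) ->
  runs (seqs [seq c x | x <- r]) (S 0) (S (size r)) (size r * T.+1 + 1).
Proof.
elim: r S => [|x r IH] S step /=; first exact: runs_skip.
rewrite (_ : _ * _ + 1 = T + (size r * T.+1 + 1) + 1); last by rewrite mulSn; lia.
apply: (@runs_seq _ _ _ (S 1)); first exact: (step 0 x).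
apply: (IH (fun k => S k.+1)) => k x0 ltk.
exact: (step k.+1 x0).
Qed.

(** [S a x] is the store with loop counter [a] and progress [x] of the work. A pass adds [d] to the
    progress; resetting the counter leaves the progress alone. *)
Lemma runs_for i r c (S : nat -> nat -> store) B u d T :
  (forall a x, a <= B -> [/\ i < size (regs (S a x)), r < size (regs (S a x)),
    nth 0 (regs (S a x)) i = a & nth 0 (regs (S a x)) r = B - a]) ->
  (forall a x, a < B -> update (Inc i) (update (Dec r) (S a x)) = S a.+1 x) ->
  (forall a x, a < B -> update (Inc r) (update (Dec i) (S a.+1 x)) = S a x) ->
  (forall a, a < B -> runs c (S a (u + a * d)) (S a (u + a.+1 * d)) T) ->
  runs (for_loop i r c) (S 0 u) (S 0 (u + B * d)) (B * (T + 10) + 3).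
Proof.
move=> get up down body.
apply: (@runs_le _ _ _ ((B * (T + 3 + 1).+1 + 1) + (B * 4 + 1) + 1)).
  by rewrite -addn1 !mulnDr; lia.
apply: (@runs_seq _ _ _ (S B (u + B * d))).
  have -> : S 0 u = S 0 (u + 0 * d) by rewrite addn0.
  apply: (@runs_while _ _ (fun a => S a (u + a * d))) => [a lta|].
    have [_ _ _ Er] := get a (u + a * d) (ltnW lta).
    split; first by rewrite /= Er; lia.
    apply: runs_seq (body a lta) _.
    rewrite -up //; have [li lr _ _] := get a (u + a.+1 * d) (ltnW lta).
    exact: runs_counts2.
  by have [_ _ _ Er] := get B (u + B * d) (leqnn B); rewrite /= Er subnn.
have := @runs_while (NonZero i) (Seq (Dec i) (Inc r))
  (fun k => S (B - k) (u + B * d)) B 3.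
rewrite subn0 subnn; apply=> [k ltk|]; last first.
  by have [_ _ Ei _] := get 0 (u + B * d) isT; rewrite /= Ei.
have [li lr Ei _] := get (B - k) (u + B * d) ltac:(lia).
split; first by rewrite /= Ei; lia.
rewrite -(down (B - k.+1)) ?subnSK //; last by lia.
exact: runs_counts2.
Qed.

Lemma runs_iter_count c n s : counts (size (regs s)) c ->
  runs (iter n (Seq c) Skip) s (iter n (update c) s) (n * 2 + 1).
Proof.
elim: n s => [|n IH] s cc; first exact: runs_skip.
rewrite iterS iterSr (_ : _ * _ + 1 = 1 + (n * 2 + 1) + 1); last by lia.
apply: runs_seq (runs_counts cc) _.
by apply: IH; rewrite size_update.
Qed.

Lemma runs_inc_n rs i o x n : x < size rs ->
  runs (iter n (Seq (Inc x)) Skip) (Store rs i o)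
    (Store (upd rs x (nth 0 rs x + n)) i o) (n * 2 + 1).
Proof.
move=> lx; have := @runs_iter_count (Inc x) n (Store rs i o) lx.
congr runs; elim: n => [|n /= ->] /=; first by rewrite addn0 upd_id.
by congr Store; upd_eq.
Qed.

Lemma runs_dec_n rs i o x n : x < size rs ->
  runs (iter n (Seq (Dec x)) Skip) (Store rs i o)
    (Store (upd rs x (nth 0 rs x - n)) i o) (n * 2 + 1).
Proof.
move=> lx; have := @runs_iter_count (Dec x) n (Store rs i o) lx.
congr runs; elim: n => [|n /= ->] /=; first by rewrite subn0 upd_id.
by congr Store; upd_eq.
Qed.

End Rules.

(** * Writing the temporal graph *)

(* Registers: 0, 2, 4, 6 are the loop counters (time and position of the clause,
   then of the variable) and 1, 3, 5, 7 their distances to the bound; 8 is the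
   current vertex, 9 the number of vertices, 10 the input length, 11 the bound
   of the loops, 12 the number of vertices in a row of cells, 13 to 16 are
   scratch, and 17 is always 0. *)
Variant feature := EqTest of nat & nat & nat & nat | InTest of cond & nat.

(** * Branching on the features *)

Definition seek_back : cmd := While (NonZero 14) (Seq (Dec 14) InL).

(** Equality is tested as the vanishing of the sum of the two truncated differences. The walk to an
    input cell uses up register 14, so it is loaded again for the way back. Either branch starts
    with clean scratch registers and the input head at 0. *)
Definition branch (t : feature) (c1 c2 : cmd) : cmd :=
  match t with
  | EqTest x a y b =>
      Seq (add 14 x 13) (Seq (iter a (Seq (Inc 14)) Skip)
      (Seq (add 15 y 13) (Seq (iter b (Seq (Inc 15)) Skip)
      (Seq (add 16 14 13) (Seq (sub 16 15 13) (Seq (sub 15 14 13)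
      (Seq (add 16 15 13) (Seq (clear 14) (Seq (clear 15)
      (If (NonZero 16) (Seq (clear 16) c2) c1))))))))))
  | InTest q x =>
      Seq (add 14 x 13) (Seq (While (NonZero 14) (Seq (Dec 14) InR))
      (Seq (add 14 x 13) (If q (Seq seek_back c1) (Seq seek_back c2))))
  end.

(** [F] is applied while the program is being built: the leaves are fixed commands, so the machine
    never evaluates the table, it only branches. *)
Fixpoint decision_tree (ts : seq feature) (F : seq bool -> cmd) : cmd :=
  if ts is t :: ts then
    branch t (decision_tree ts (fun l => F (true :: l)))
             (decision_tree ts (fun l => F (false :: l)))
  else F [::].

Section Branch.
Variable w : word.
Local Notation runs := (runs w).
Local Notation upd rs x v := (set_nth 0 rs x v).

Definition feature_val (rs : seq nat) (t : feature) : bool :=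
  match t with
  | EqTest x a y b => nth 0 rs x + a == nth 0 rs y + b
  | InTest q x => test w q (Store rs (nth 0 rs x) [::])
  end.

Definition readable (x : nat) : bool := (x < 13) || (x == 17).

Definition feature_ok (t : feature) : bool :=
  match t with
  | EqTest x a y b => [&& readable x, readable y, a < 2 & b < 2]
  | InTest q x => readable x && (if q is NonZero _ then false else true)
  end.

Variables (rs : seq nat) (o : word) (X : nat).
Hypothesis size_rs : size rs = 18.
Hypothesis scratch0 : forall x, 13 <= x <= 16 -> nth 0 rs x = 0.
Hypothesis le_X : forall x, nth 0 rs x <= X.

Lemma runs_add_eq rs1 rs2 i x y z T : size rs1 = 18 -> x < 18 -> y < 18 -> z < 18 ->
  [&& x != y, x != z & y != z] -> nth 0 rs1 z = 0 ->
  rs2 = upd rs1 x (nth 0 rs1 x + nth 0 rs1 y) -> 10 * nth 0 rs1 y + 3 <= T ->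
  runs (add x y z) (Store rs1 i o) (Store rs2 i o) T.
Proof.
move=> sz lx ly lz /and3P[? ? ?] z0 -> le; apply: runs_le le _.
by apply: runs_add; rewrite ?sz.
Qed.

Lemma runs_sub_eq rs1 rs2 i x y z T : size rs1 = 18 -> x < 18 -> y < 18 -> z < 18 ->
  [&& x != y, x != z & y != z] -> nth 0 rs1 z = 0 ->
  rs2 = upd rs1 x (nth 0 rs1 x - nth 0 rs1 y) -> 10 * nth 0 rs1 y + 3 <= T ->
  runs (sub x y z) (Store rs1 i o) (Store rs2 i o) T.
Proof.
move=> sz lx ly lz /and3P[? ? ?] z0 -> le; apply: runs_le le _.
by apply: runs_sub; rewrite ?sz.
Qed.

Lemma runs_clear_eq rs1 rs2 i x T : size rs1 = 18 -> x < 18 ->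
  rs2 = upd rs1 x 0 -> nth 0 rs1 x * 2 + 1 <= T ->
  runs (clear x) (Store rs1 i o) (Store rs2 i o) T.
Proof.
by move=> sz lx -> le; apply: runs_le le _; apply: runs_clear; rewrite ?sz.
Qed.

Lemma runs_inc_n_eq rs1 rs2 i x n T : size rs1 = 18 -> x < 18 ->
  rs2 = upd rs1 x (nth 0 rs1 x + n) -> n * 2 + 1 <= T ->
  runs (iter n (Seq (Inc x)) Skip) (Store rs1 i o) (Store rs2 i o) T.
Proof.
by move=> sz lx -> le; apply: runs_le le _; apply: runs_inc_n; rewrite ?sz.
Qed.

Definition scratch (p q l : nat) : seq nat := upd (upd (upd rs 14 p) 15 q) 16 l.

Lemma size_scr p q l : size (scratch p q l) = 18.
Proof. by rewrite /scratch !size_upd ?size_upd ?size_rs. Qed.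

Lemma nth_scr p q l x : nth 0 (scratch p q l) x =
  if x == 16 then l else if x == 15 then q else if x == 14 then p else nth 0 rs x.
Proof. by rewrite /scratch !nth_upd. Qed.

Lemma scr_eq p q l rs1 : size rs1 = 18 ->
  (forall x, nth 0 rs1 x = if x == 16 then l else if x == 15 then q
    else if x == 14 then p else nth 0 rs x) -> scratch p q l = rs1.
Proof. by move=> sz E; apply: regs_eq => [|x]; rewrite ?size_scr // nth_scr E. Qed.

Lemma scr0 : scratch 0 0 0 = rs.
Proof.
apply: scr_eq => // x; do 3!(case: eqP => [->|_]; first by rewrite scratch0).
by [].
Qed.

Lemma scr13 p q l : nth 0 (scratch p q l) 13 = 0.
Proof. by rewrite nth_scr /= scratch0. Qed.

Lemma scr_readable p q l x : readable x -> nth 0 (scratch p q l) x = nth 0 rs x.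
Proof. by move=> rx; rewrite nth_scr; do 3!(case: eqP rx => [-> //|_ rx]). Qed.

Lemma runs_eq_test x a y b c1 c2 s' T : feature_ok (EqTest x a y b) ->
  runs (if nth 0 rs x + a == nth 0 rs y + b then c1 else c2) (Store rs 0 o) s' T ->
  runs (branch (EqTest x a y b) c1 c2) (Store rs 0 o) s' (T + (100 * X + 200)).
Proof.
case/and4P=> rx ry lta ltb run.
have [lex ley] := (le_X x, le_X y).
set p := nth 0 rs x + a; set q := nth 0 rs y + b.
have lp : p <= X + 1 by rewrite /p; lia.
have lq : q <= X + 1 by rewrite /q; lia.
have x18 : x < 18 by move: rx; rewrite /readable; lia.
have y18 : y < 18 by move: ry; rewrite /readable; lia.
have xs : x \notin [:: 13; 14; 15; 16] by rewrite !inE; move: rx; rewrite /readable; lia.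
have ys : y \notin [:: 13; 14; 15; 16] by rewrite !inE; move: ry; rewrite /readable; lia.
move: xs ys; rewrite !inE !negb_or => /and4P[x13 x14 x15 x16] /and4P[y13 y14 y15 y16].
pose l := (p - q) + (q - p).
have fin : runs (If (NonZero 16) (Seq (clear 16) c2) c1) (Store (scratch 0 0 l) 0 o) s'
    (T + 2 * X + 10).
  apply: (@runs_le _ _ _ _ (T + 2 * X + 9).+1); first by lia.
  apply: runs_if; rewrite /= nth_scr /=.
  have -> : (l != 0) = (p != q) by rewrite /l; lia.
  case: eqP run => [Epq|_] run /=.
    have -> : l = 0 by rewrite /l /p /q Epq subnn.
    by rewrite scr0; apply: runs_le run; lia.
  apply: (@runs_le _ _ _ _ ((2 * X + 5) + T + 1)); first by lia.
  apply: runs_seq run; apply: runs_clear_eq => //.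
  - by rewrite size_scr.
  - by rewrite -[LHS]scr0 /scratch; apply: regs_eq => [|k];
      [rewrite !size_upd ?size_upd ?size_rs | rewrite !nth_upd; case: eqP].
  by rewrite nth_scr /= /l; lia.
have nx u v k : nth 0 (scratch u v k) x = nth 0 rs x by apply: scr_readable.
have ny u v k : nth 0 (scratch u v k) y = nth 0 rs y by apply: scr_readable.
have n14 u v k : nth 0 (scratch u v k) 14 = u by rewrite nth_scr.
have n15 u v k : nth 0 (scratch u v k) 15 = v by rewrite nth_scr.
have n16 u v k : nth 0 (scratch u v k) 16 = k by rewrite nth_scr.
have eqs u v k u' v' k' r z : (r == 14) && [&& u' == z, v' == v & k' == k]
    || (r == 15) && [&& u' == u, v' == z & k' == k]
    || (r == 16) && [&& u' == u, v' == v & k' == z] ->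
    scratch u' v' k' = upd (scratch u v k) r z.
  by case/orP=> [/orP[]|] /andP[/eqP -> /and3P[/eqP -> /eqP -> /eqP ->]];
    (apply: scr_eq => [|n]; first by rewrite size_upd ?size_scr);
    rewrite nth_upd nth_scr; do !case: eqP => // ->.
pose G := 10 * X + 20.
apply: (@runs_le _ _ _ _ (G + (4 + (G + (4 + (G + (G + (G + (G + ((2 * X + 5) +
  ((2 * X + 5) + (T + 2 * X + 10) + 1) + 1) + 1) + 1) + 1) + 1) + 1) + 1) + 1) + 1)).
  by rewrite /G; lia.
rewrite (_ : Store rs 0 o = Store (scratch 0 0 0) 0 o); last by rewrite scr0.
apply: (@runs_seq _ _ _ _ (Store (scratch (nth 0 rs x) 0 0) 0 o)).
  apply: runs_add_eq; rewrite ?size_scr ?scr13 ?nx ?n14 //; first by lia.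
    by apply: eqs; rewrite !eqxx.
  by rewrite /G; lia.
apply: (@runs_seq _ _ _ _ (Store (scratch p 0 0) 0 o)).
  apply: runs_inc_n_eq; rewrite ?size_scr ?n14 //; last by lia.
  by apply: eqs; rewrite !eqxx.
apply: (@runs_seq _ _ _ _ (Store (scratch p (nth 0 rs y) 0) 0 o)).
  apply: runs_add_eq; rewrite ?size_scr ?scr13 ?ny ?n15 //; first by lia.
    by apply: eqs; rewrite !eqxx ?orbT.
  by rewrite /G; lia.
apply: (@runs_seq _ _ _ _ (Store (scratch p q 0) 0 o)).
  apply: runs_inc_n_eq; rewrite ?size_scr ?n15 //; last by lia.
  by apply: eqs; rewrite !eqxx ?orbT.
apply: (@runs_seq _ _ _ _ (Store (scratch p q p) 0 o)).
  apply: runs_add_eq; rewrite ?size_scr ?scr13 ?n16 ?n14 //.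
    by apply: eqs; rewrite !eqxx ?orbT.
  by rewrite /G; lia.
apply: (@runs_seq _ _ _ _ (Store (scratch p q (p - q)) 0 o)).
  apply: runs_sub_eq; rewrite ?size_scr ?scr13 ?n16 ?n15 //.
    by apply: eqs; rewrite !eqxx ?orbT.
  by rewrite /G; lia.
apply: (@runs_seq _ _ _ _ (Store (scratch p (q - p) (p - q)) 0 o)).
  apply: runs_sub_eq; rewrite ?size_scr ?scr13 ?n15 ?n14 //.
    by apply: eqs; rewrite !eqxx ?orbT.
  by rewrite /G; lia.
apply: (@runs_seq _ _ _ _ (Store (scratch p (q - p) l) 0 o)).
  apply: runs_add_eq; rewrite ?size_scr ?scr13 ?n16 ?n15 //.
    by apply: eqs; rewrite !eqxx ?orbT.
  by rewrite /G; lia.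
apply: (@runs_seq _ _ _ _ (Store (scratch 0 (q - p) l) 0 o)).
  apply: runs_clear_eq; rewrite ?size_scr ?n14 //; last by lia.
  by apply: eqs; rewrite !eqxx ?orbT.
apply: runs_seq fin; apply: runs_clear_eq; rewrite ?size_scr ?n15 //; last by lia.
by apply: eqs; rewrite !eqxx ?orbT.
Qed.

Lemma runs_in_test q x c1 c2 s' T : feature_ok (InTest q x) ->
  runs (if test w q (Store rs (nth 0 rs x) o) then c1 else c2) (Store rs 0 o) s' T ->
  runs (branch (InTest q x) c1 c2) (Store rs 0 o) s' (T + (100 * X + 200)).
Proof.
case/andP=> rx qx run; have lex := le_X x.
set v := nth 0 rs x in lex run *.
have x18 : x < 18 by move: rx; rewrite /readable; lia.
have x13 : (x != 13) && (x != 14) by move: rx; rewrite /readable; lia.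
have nx k : nth 0 (scratch k 0 0) x = v by apply: scr_readable.
have n14 k : nth 0 (scratch k 0 0) 14 = k by rewrite nth_scr.
have eq14 k k' : scratch k' 0 0 = upd (scratch k 0 0) 14 k'.
  apply: regs_eq => [|n]; first by rewrite size_upd ?size_scr.
  by rewrite nth_upd !nth_scr; have [->|] := eqVneq n 14.
have load i : runs (add 14 x 13) (Store (scratch 0 0 0) i o) (Store (scratch v 0 0) i o)
    (10 * X + 3).
  apply: runs_add_eq; rewrite ?size_scr ?scr13 ?nx ?n14 //; lia.
have back : runs seek_back (Store (scratch v 0 0) v o) (Store rs 0 o) (4 * X + 1).
  apply: (@runs_le _ _ _ _ (v * 4 + 1)); first by lia.
  have := @runs_while w (NonZero 14) (Seq (Dec 14) InL)
    (fun k => Store (scratch (v - k) 0 0) (v - k) o) v 3.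
  rewrite subnn subn0 scr0; apply=> [k ltk|]; last by rewrite /= scratch0.
  split; first by rewrite /= n14; lia.
  apply: (@runs_seq _ _ _ _ (Store (scratch (v - k.+1) 0 0) (v - k) o) _ 1 1).
    have := @runs_counts w (Dec 14) (Store (scratch (v - k) 0 0) (v - k) o).
    by rewrite /= size_scr n14 -subnS -eq14; apply.
  have := @runs_update w InL (Store (scratch (v - k.+1) 0 0) (v - k) o).
  by rewrite /= -subnS; apply; lia.
have fwd : runs (While (NonZero 14) (Seq (Dec 14) InR)) (Store (scratch v 0 0) 0 o)
    (Store rs v o) (4 * X + 1).
  apply: (@runs_le _ _ _ _ (v * 4 + 1)); first by lia.
  have := @runs_while w (NonZero 14) (Seq (Dec 14) InR)
    (fun k => Store (scratch (v - k) 0 0) k o) v 3.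
  rewrite subnn subn0 scr0; apply=> [k ltk|]; last by rewrite /= scratch0.
  split; first by rewrite /= n14; lia.
  apply: (@runs_seq _ _ _ _ (Store (scratch (v - k.+1) 0 0) k o) _ 1 1).
    have := @runs_counts w (Dec 14) (Store (scratch (v - k) 0 0) k o).
    by rewrite /= size_scr n14 -subnS -eq14; apply.
  exact: (@runs_update w InR (Store (scratch (v - k.+1) 0 0) k o)).
apply: (@runs_le _ _ _ _ ((10 * X + 3) + ((4 * X + 1) + ((10 * X + 3) +
  ((4 * X + 1) + T + 1).+1 + 1) + 1) + 1)); first by lia.
apply: (@runs_seq _ _ _ _ (Store (scratch v 0 0) 0 o)); first by rewrite -scr0; apply: load.
apply: runs_seq fwd _.
apply: (@runs_seq _ _ _ _ (Store (scratch v 0 0) v o)); first by rewrite -scr0; apply: load.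
apply: runs_if.
have -> : test w q (Store (scratch v 0 0) v o) = test w q (Store rs v o) by case: (q) qx.
by case: ifP run => _ run; apply: runs_seq back run.
Qed.

Lemma runs_branch t c1 c2 s' T : feature_ok t ->
  runs (if feature_val rs t then c1 else c2) (Store rs 0 o) s' T ->
  runs (branch t c1 c2) (Store rs 0 o) s' (T + (100 * X + 200)).
Proof.
case: t => [x a y b|q x] ok; first exact: runs_eq_test.
by move=> run; apply: runs_in_test.
Qed.

Lemma runs_decision_tree ts F s' T : all feature_ok ts ->
  runs (F [seq feature_val rs t | t <- ts]) (Store rs 0 o) s' T ->
  runs (decision_tree ts F) (Store rs 0 o) s' (T + size ts * (100 * X + 200)).
Proof.
elim: ts F => [|t ts IH] F /=; first by rewrite addn0.
case/andP=> okt okts run; rewrite mulSn addnCA addnC.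
apply: runs_branch => //; case: ifP run => _ run; exact: IH.
Qed.

End Branch.

Definition features_code : seq feature :=
  [:: EqTest 0 0 17 0; EqTest 0 1 11 0; EqTest 2 0 17 0; EqTest 2 1 11 0;
      EqTest 4 0 17 0; EqTest 4 1 11 0; EqTest 6 0 17 0; EqTest 6 1 11 0;
      EqTest 4 0 0 0; EqTest 4 0 0 1; EqTest 6 0 2 0; EqTest 6 0 2 1;
      EqTest 2 0 6 1; InTest InNonblank 2; InTest InOne 2].

(** * Printing one row of an adjacency matrix *)

Definition shift_code (s : shift) : cmd :=
  match s with
  | Here => Skip
  | NextRow => add 14 12 13
  | PrevRow => sub 14 12 13
  | NextCol => iter 8 (Seq (Inc 14)) Skip
  | PrevCol => iter 8 (Seq (Dec 14)) Skip
  end.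

Definition row_code (x : option (shift * nat)) (g : nat) : cmd :=
  if x is Some (s, g') then
    Seq (add 14 8 13) (Seq (shift_code s)
    (Seq (iter g (Seq (Dec 14)) Skip) (Seq (iter g' (Seq (Inc 14)) Skip)
    (Seq (add 15 9 13) (Seq (sub 15 14 13) (Seq (Dec 15)
    (Seq (emit_all 14 false) (Seq (Emit true) (emit_all 15 false)))))))))
  else Seq (add 15 9 13) (emit_all 15 false).

Definition row (N : nat) (x : option nat) : word :=
  if x is Some m then nseq m false ++ true :: nseq (N - m.+1) false
  else nseq N false.

Section Body.
Variable w : word.
Variables (B N V8 : nat).
Local Notation runs := (runs w).

Definition loop_regs (t p t' p' u P Q : nat) : seq nat :=
  [:: t; B - t; p; B - p; t'; B - t'; p'; B - p'; u; N; size w; B; V8; 0; P; Q; 0; 0].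

Lemma features_codeE t p t' p' u :
  [seq feature_val w (loop_regs t p t' p' u 0 0) x | x <- features_code] =
  features B w t p t' p'.
Proof. by rewrite /= !addn0 !addn1. Qed.

Definition shifted_num (s : shift) (u : nat) : nat :=
  match s with
  | Here => u
  | NextRow => u + V8
  | PrevRow => u - V8
  | NextCol => u + 8
  | PrevCol => u - 8
  end.

Variables (t p t' p' u : nat).
Variables (X : nat).
Hypotheses (le_u : u <= X) (le_N : N <= X) (le_V8 : V8 <= X).

Lemma runs_row_code x g o : g < 8 -> (if x is Some y then y.2 < 8 else true) ->
  runs (row_code x g) (Store (loop_regs t p t' p' u 0 0) 0 o)
    (Store (loop_regs t p t' p' u 0 0) 0
      (o ++ row N (omap (fun y => shifted_num y.1 u - g + y.2) x)))
    (100 * X + 400).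
Proof.
move=> ltg.
have addQ P : runs (add 15 9 13) (Store (loop_regs t p t' p' u P 0) 0 o)
    (Store (loop_regs t p t' p' u P N) 0 o) (10 * X + 3).
  by apply: runs_add_eq => //=; lia.
case: x => [[s g']|] /= ltg'; last first.
  apply: (@runs_le _ _ _ _ ((10 * X + 3) + (N * 4 + 1) + 1)); first by lia.
  by apply: runs_seq (addQ 0) _; apply: (@runs_emit_all w _ 0 o 15).
have le_s : shifted_num s u <= 2 * X + 8 by case: s => /=; lia.
set P1 := shifted_num s u in le_s *.
set P2 := P1 - g; set P3 := P2 + g'.
have leP3 : P3 <= 2 * X + 16 by rewrite /P3 /P2; lia.
apply: (@runs_le _ _ _ _ ((10 * X + 3) + ((10 * X + 17) + ((g * 2 + 1) +
  ((g' * 2 + 1) + ((10 * X + 3) + ((10 * P3 + 3) + (1 + ((P3 * 4 + 1) + (1 +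
   (X * 4 + 1) + 1) + 1) + 1) + 1) + 1) + 1) + 1) + 1) + 1)); first by lia.
apply: (@runs_seq _ _ _ _ (Store (loop_regs t p t' p' u u 0) 0 o)).
  by apply: runs_add_eq => //=; lia.
apply: (@runs_seq _ _ _ _ (Store (loop_regs t p t' p' u P1 0) 0 o)).
  rewrite /P1; case: s {P1 P2 P3 le_s leP3} => /=.
  - by apply: (@runs_le _ _ _ _ 1); [lia | apply: runs_skip].
  - by apply: runs_add_eq => //=; lia.
  - by apply: runs_sub_eq => //=; lia.
  - by apply: (@runs_inc_n_eq w o _ _ 0 14 8) => //=; lia.
  apply: (@runs_le _ _ _ _ (8 * 2 + 1)); first by lia.
  exact: (@runs_dec_n w (loop_regs t p t' p' u u 0) 0 o 14 8).
apply: (@runs_seq _ _ _ _ (Store (loop_regs t p t' p' u P2 0) 0 o)).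
  exact: (@runs_dec_n w (loop_regs t p t' p' u P1 0) 0 o 14 g).
apply: (@runs_seq _ _ _ _ (Store (loop_regs t p t' p' u P3 0) 0 o)).
  exact: (@runs_inc_n w (loop_regs t p t' p' u P2 0) 0 o 14 g').
apply: runs_seq (addQ P3) _.
apply: (@runs_seq _ _ _ _ (Store (loop_regs t p t' p' u P3 (N - P3)) 0 o)).
  by apply: runs_sub_eq.
apply: (@runs_seq _ _ _ _ (Store (loop_regs t p t' p' u P3 (N - P3.+1)) 0 o)).
  by rewrite subnS; apply: (@runs_dec w _ 0 o 15).
apply: (@runs_seq _ _ _ _ (Store (loop_regs t p t' p' u 0 (N - P3.+1)) 0 (o ++ nseq P3 false))).
  exact: (@runs_emit_all w (loop_regs t p t' p' u P3 (N - P3.+1)) 0 o 14).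
apply: (@runs_seq _ _ _ _ (Store (loop_regs t p t' p' u 0 (N - P3.+1)) 0
  (rcons (o ++ nseq P3 false) true))).
  exact: (@runs_update w (Emit true)).
apply: (@runs_le _ _ _ _ ((N - P3.+1) * 4 + 1)); first by lia.
have := @runs_emit_all w (loop_regs t p t' p' u 0 (N - P3.+1)) 0
  (rcons (o ++ nseq P3 false) true) 15 false isT.
by rewrite /= -cats1 -!catA.
Qed.

End Body.

Lemma mixed_radix_first (B K t p k : nat) : 0 < B -> 0 < K ->
  ((t * B + p) * K + k == 0) = [&& t == 0, p == 0 & k == 0].
Proof.
move=> B0 K0; rewrite !(addn_eq0, muln_eq0).
by case: B B0 => // b _; case: K K0 => // k' _; rewrite !orbF andbA.
Qed.

(** The largest number has all its digits maximal, and digits are unique. Thus the border flags of a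
    cell can be computed from the features and from the constants [k] and [c]. *)
Lemma mixed_radix_last (B K t p k : nat) : t < B -> p < B -> k < K ->
  (((t * B + p) * K + k).+1 == B * B * K) =
  [&& t.+1 == B, p.+1 == B & k.+1 == K].
Proof.
move=> ltt ltp ltk; apply/eqP/and3P => [E|[/eqP <- /eqP [E] /eqP <-]]; last first.
  by rewrite E; lia.
have [B0 K0] : 0 < B /\ 0 < K by lia.
have E' : (t * B + p) * K + k = (B.-1 * B + B.-1) * K + K.-1.
  have EB : B.-1 * B + B.-1 + 1 = B * B by case: (B) B0 => // b _; lia.
  have EK : (B.-1 * B + B.-1) * K + K.-1 + 1 = B * B * K.
    by rewrite -EB; move: (_ * B + _) => m; lia.
  by apply: succn_inj; rewrite E -EK addn1.
have lB : B.-1 < B by lia. have lK : K.-1 < K by lia.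
have [d1 d2 d3] := mixed_radixK t ltp ltk.
have := mixed_radixK B.-1 lB lK; rewrite /= -E' d1 d2 d3 => -[-> -> ->].
by rewrite !prednK // !eqxx.
Qed.

(** * Printing the adjacency matrix of a snapshot *)

Section Vertex.
Variables (K1 K2 : nat) (tbl : nat -> nat -> seq bool -> entry).

Definition slot_code (t k c g : nat) (f : seq bool) : option (shift * nat) :=
  let b := nth false f in
  slot t g (tbl k c f) [&& b 0, b 2 & k == 0] [&& b 1, b 3 & k.+1 == K1]
    [&& b 4, b 6 & c == 0] [&& b 5, b 7 & c.+1 == K2].

Definition vertex_code (t k c g : nat) : cmd :=
  Seq (decision_tree features_code (fun f => row_code (slot_code t k c g f) g))
      (Inc 8).

(** Only the digits bounded by [B] need loops at run time; [k], [c] and [g] have constant ranges and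
    are unrolled. The nesting follows the numbering of the vertices, so register 8 just counts. *)
Definition snapshot_code (t : nat) : cmd :=
  Seq (for_loop 0 1 (for_loop 2 3 (seqs [seq for_loop 4 5 (for_loop 6 7
         (seqs [seq seqs [seq vertex_code t k c g | g <- iota 0 8]
               | c <- iota 0 K2])) | k <- iota 0 K1])))
      (clear 8).

Variables (w : word) (B : nat).
Hypotheses (K1_gt0 : 0 < K1) (K2_gt0 : 0 < K2) (B_gt0 : 0 < B).

Local Notation J := (B * B * K1).
Local Notation V := (B * B * K2).
Local Notation N := (gadget_order J V).
Local Notation A := (tableau_cnf B w K1 K2 tbl).

Definition vertex_row (t u : nat) : word := row N (partner J V A t u).

(** In the row-major numbering a row of cells is an offset of [V * 8] and a column an offset of 8.
    The flags rule out leaving the first row or column backwards, so no subtraction is truncated. *)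
Lemma slot_codeE t tau p k tau' p' c g : t < 23 -> tau < B -> p < B -> k < K1 ->
  tau' < B -> p' < B -> c < K2 -> g < 8 ->
  let j := (tau * B + p) * K1 + k in let v := (tau' * B + p') * K2 + c in
  let u := (j * V + v) * 8 + g in
  omap (fun y => shifted_num (V * 8) y.1 u - g + y.2)
    (slot_code t k c g (features B w tau p tau' p')) = partner J V A t u.
Proof.
move=> ltt ltau ltp ltk ltau' ltp' ltc ltg j v u.
have ltj : j < J by apply: mixed_radix_lt.
have ltv : v < V by apply: mixed_radix_lt.
have rng : in_range J V (j, v, g) by rewrite /= ltj ltv ltg.
rewrite /partner -[u]/(num_of V (j, v, g)) (num_ofK _ rng); last by rewrite !muln_gt0 B_gt0.
rewrite /partner3 /slot_at.
have -> : A j v = tbl k c (features B w tau p tau' p').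
  rewrite /tableau_cnf /j /v.
  have [-> -> ->] := mixed_radixK tau ltp ltk.
  by have [-> -> ->] := mixed_radixK tau' ltp' ltc.
rewrite /slot_code /= -(mixed_radix_first tau p k B_gt0 K1_gt0)
  -(mixed_radix_first tau' p' c B_gt0 K2_gt0) -(mixed_radix_last ltau ltp ltk)
  -(mixed_radix_last ltau' ltp' ltc) -/j -/v.
case E: slot => [[s g']|] //=; congr Some.
have := slotP ltt E; rewrite /num_of; case: s {E} => /=.
- by move=> _; lia.
- by move=> _; rewrite mulSn; lia.
- case=> /eqP j0 _ _ _; rewrite -/j in j0 *.
  by case: (j) j0 => // j1 _; rewrite mulSn /=; lia.
- by move=> _; lia.
by case=> /eqP v0 _ _ _; lia.
Qed.

Variables (t : nat) (o : word).
Hypothesis ltt : t < 23.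

Definition snapshot_store (tau p tau' p' u : nat) : store :=
  Store (loop_regs w B N (V * 8) tau p tau' p' u 0 0) 0
    (o ++ flatten [seq vertex_row t x | x <- iota 0 u]).

Definition maxreg : nat := N + B + V * 8 + size w.
Definition vertex_time : nat := 15 * (100 * maxreg + 200) + (100 * maxreg + 400) + 2.

Lemma runs_vertex tau p k tau' p' c g u : tau < B -> p < B -> k < K1 ->
  tau' < B -> p' < B -> c < K2 -> g < 8 ->
  u = (((tau * B + p) * K1 + k) * V + ((tau' * B + p') * K2 + c)) * 8 + g ->
  runs w (vertex_code t k c g) (snapshot_store tau p tau' p' u) (snapshot_store tau p tau' p' u.+1) vertex_time.
Proof.
move=> ltau ltp ltk ltau' ltp' ltc ltg Eu.
have ltu : u < N.
  rewrite Eu; apply: (@num_of_lt J V _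
    ((tau * B + p) * K1 + k, (tau' * B + p') * K2 + c, g)).
    by rewrite !muln_gt0 B_gt0.
  by rewrite /= !mixed_radix_lt.
have row_u : omap (fun y => shifted_num (V * 8) y.1 u - g + y.2)
    (slot_code t k c g (features B w tau p tau' p')) = partner J V A t u.
  by rewrite Eu; apply: slot_codeE.
have Eo : o ++ flatten [seq vertex_row t x | x <- iota 0 u.+1] =
    (o ++ flatten [seq vertex_row t x | x <- iota 0 u]) ++ vertex_row t u.
  by rewrite -addn1 iotaD map_cat flatten_cat /= cats0 catA.
apply: (@runs_le _ _ _ _ ((100 * maxreg + 400 + 15 * (100 * maxreg + 200)) + 1 + 1)).
  by rewrite /vertex_time; lia.
apply: (@runs_seq _ _ _ _ (Store (loop_regs w B N (V * 8) tau p tau' p' u 0 0) 0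
    (o ++ flatten [seq vertex_row t x | x <- iota 0 u.+1]))); last first.
  exact: (@runs_inc w _ 0 _ 8).
have lm x : nth 0 (loop_regs w B N (V * 8) tau p tau' p' u 0 0) x <= maxreg.
  by rewrite /maxreg; do 18?[case: x => [|x]]; rewrite /= ?nth_nil; lia.
have s0 x : 13 <= x <= 16 -> nth 0 (loop_regs w B N (V * 8) tau p tau' p' u 0 0) x = 0.
  by do 18?[case: x => [|x] //].
apply: (@runs_decision_tree w _ _ _ _ s0 lm features_code) => //.
rewrite features_codeE Eo /vertex_row -row_u.
apply: runs_row_code => //; rewrite /maxreg; try lia.
case E: slot_code => [[s g']|] //=.
by have := slotP ltt E; case: s {E} => [[]|[]|[]|[]|[]] // _ _ -> _.
Qed.

Definition time8 := 8 * vertex_time.+1 + 1.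
Definition time_c := K2 * time8.+1 + 1.
Definition time_p' := B * (time_c + 10) + 3.
Definition time_t' := B * (time_p' + 10) + 3.
Definition time_k := K1 * time_t'.+1 + 1.
Definition time_p := B * (time_k + 10) + 3.
Definition snapshot_time := B * (time_p + 10) + 3 + (N * 2 + 1) + 1.

Lemma runs_cell tau p k tau' p' c : tau < B -> p < B -> k < K1 ->
  tau' < B -> p' < B -> c < K2 ->
  let u := (((tau * B + p) * K1 + k) * V + ((tau' * B + p') * K2 + c)) * 8 in
  runs w (seqs [seq vertex_code t k c g | g <- iota 0 8])
    (snapshot_store tau p tau' p' u) (snapshot_store tau p tau' p' (u + 8)) time8.
Proof.
move=> ltau ltp ltk ltau' ltp' ltc u.
have := @runs_seqs w _ (iota 0 8) (vertex_code t k c)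
  (fun g => snapshot_store tau p tau' p' (u + g)) vertex_time.
rewrite addn0 size_iota; apply=> g x0 ltg.
by rewrite nth_iota // add0n addnS; apply: runs_vertex.
Qed.

Lemma runs_column tau p k tau' p' : tau < B -> p < B -> k < K1 ->
  tau' < B -> p' < B ->
  let u := (((tau * B + p) * K1 + k) * V + (tau' * B + p') * K2) * 8 in
  runs w (seqs [seq seqs [seq vertex_code t k c g | g <- iota 0 8] | c <- iota 0 K2])
    (snapshot_store tau p tau' p' u) (snapshot_store tau p tau' p' (u + K2 * 8)) time_c.
Proof.
move=> ltau ltp ltk ltau' ltp' u.
have := @runs_seqs w _ (iota 0 K2)
  (fun c => seqs [seq vertex_code t k c g | g <- iota 0 8])
  (fun c => snapshot_store tau p tau' p' (u + c * 8)) time8.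
rewrite addn0 size_iota; apply=> c x0 ltc.
have := runs_cell ltau ltp ltk ltau' ltp' ltc; rewrite nth_iota // add0n.
by congr runs; congr snapshot_store; rewrite /u; lia.
Qed.

Ltac for_sides := move=> a x lta;
  by [split=> //; rewrite /snapshot_store /= ?subn0; lia
     | rewrite /snapshot_store /loop_regs /= ?subnS | rewrite /snapshot_store /loop_regs /= subnSK].

Lemma runs_row_p tau p k tau' : tau < B -> p < B -> k < K1 -> tau' < B ->
  let u := (((tau * B + p) * K1 + k) * V + tau' * B * K2) * 8 in
  runs w (for_loop 6 7 (seqs [seq seqs [seq vertex_code t k c g | g <- iota 0 8]
                             | c <- iota 0 K2]))
    (snapshot_store tau p tau' 0 u) (snapshot_store tau p tau' 0 (u + B * (K2 * 8))) time_p'.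
Proof.
move=> ltau ltp ltk ltau' u.
apply: (@runs_for w 6 7 _ (fun a x => snapshot_store tau p tau' a x) B u (K2 * 8) time_c);
  [by for_sides | by for_sides | by for_sides | move=> a lta].
have := runs_column ltau ltp ltk ltau' lta.
by congr runs; congr snapshot_store; rewrite /u; lia.
Qed.

Lemma runs_row_t tau p k : tau < B -> p < B -> k < K1 ->
  let u := ((tau * B + p) * K1 + k) * V * 8 in
  runs w (for_loop 4 5 (for_loop 6 7
           (seqs [seq seqs [seq vertex_code t k c g | g <- iota 0 8]
                 | c <- iota 0 K2])))
    (snapshot_store tau p 0 0 u) (snapshot_store tau p 0 0 (u + B * (B * (K2 * 8)))) time_t'.
Proof.
move=> ltau ltp ltk u.
apply: (@runs_for w 4 5 _ (fun a x => snapshot_store tau p a 0 x) B u (B * (K2 * 8)) time_p');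
  [by for_sides | by for_sides | by for_sides | move=> a lta].
have := runs_row_p ltau ltp ltk lta.
by congr runs; congr snapshot_store; rewrite /u; lia.
Qed.

Lemma runs_snapshot : runs w (snapshot_code t) (snapshot_store 0 0 0 0 0)
  (Store (loop_regs w B N (V * 8) 0 0 0 0 0 0 0) 0
    (o ++ flatten [seq vertex_row t x | x <- iota 0 N])) snapshot_time.
Proof.
apply: (@runs_seq _ _ _ _ (snapshot_store 0 0 0 0 N)); last first.
  exact: (@runs_clear w (loop_regs w B N (V * 8) 0 0 0 0 N 0 0) 0 _ 8).
(* The factors are regrouped in the order of the loops, to match the progress made by each level. *)
have -> : N = 0 + B * (B * (K1 * (V * 8))) by rewrite /gadget_order; lia.
apply: (@runs_for w 0 1 _ (fun a x => snapshot_store a 0 0 0 x));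
  [by for_sides | by for_sides | by for_sides | move=> tau ltau].
have -> : 0 + tau.+1 * (B * (K1 * (V * 8))) =
  tau * (B * (K1 * (V * 8))) + B * (K1 * (V * 8)) by lia.
rewrite add0n; set u := tau * _.
apply: (@runs_for w 2 3 _ (fun a x => snapshot_store tau a 0 0 x));
  [by for_sides | by for_sides | by for_sides | move=> p ltp].
have := @runs_seqs w _ (iota 0 K1) (fun k => for_loop 4 5 (for_loop 6 7
    (seqs [seq seqs [seq vertex_code t k c g | g <- iota 0 8] | c <- iota 0 K2])))
  (fun k => snapshot_store tau p 0 0 (u + p * (K1 * (V * 8)) + k * (V * 8))) time_t'.
rewrite addn0 size_iota => H.
have -> : u + p.+1 * (K1 * (V * 8)) = u + p * (K1 * (V * 8)) + K1 * (V * 8) by lia.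
apply: H => k x0 ltk; rewrite nth_iota // add0n.
have := runs_row_t ltau ltp ltk.
by congr runs; congr snapshot_store; rewrite /u; lia.
Qed.

End Vertex.

(** * The complete program *)

Definition mul_const (x c : nat) : cmd :=
  Seq (iter c (Seq (Inc 14)) Skip) (Seq (mul x 14 13 16) (clear 14)).

Definition length_code : cmd :=
  Seq (While InNonblank (Seq InR (Inc 10))) (Seq (add 14 10 13) seek_back).

Section Program.
Variables (a d K1 K2 : nat) (tbl : nat -> nat -> seq bool -> entry).

Definition bound_code : cmd :=
  Seq (Inc 11) (Seq (iter d (Seq (mul 11 10 13 16)) Skip)
  (Seq (mul_const 11 a) (Seq (iter a (Seq (Inc 11)) Skip) (Inc 11)))).

Definition row_size_code : cmd :=
  Seq (add 12 11 13) (Seq (mul 12 11 13 16)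
  (Seq (mul_const 12 K2) (mul_const 12 8))).

Definition order_code : cmd :=
  Seq (add 9 11 13) (Seq (mul 9 11 13 16) (Seq (mul_const 9 K1)
  (Seq (mul 9 12 13 16) Skip))).

Definition header_code : cmd :=
  Seq (add 1 11 13) (Seq (add 3 11 13) (Seq (add 5 11 13) (Seq (add 7 11 13)
  (Seq (add 14 9 13) (Seq (emit_all 14 true)
  (seqs [seq Emit b | b <- false :: unary 23 ++ unary 2 ++ unary 4])))))).

Definition program : cmd :=
  Seq length_code (Seq bound_code (Seq row_size_code (Seq order_code
  (Seq header_code (seqs [seq snapshot_code K1 K2 tbl t | t <- iota 0 23]))))).

Variable w : word.
Local Notation n := (size w).
Definition bound : nat := (a * n ^ d + a).+1.
Local Notation B := bound.
Local Notation J := (B * B * K1).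
Local Notation V := (B * B * K2).
Local Notation N := (gadget_order J V).

Definition setup_regs (r1 r3 r5 r7 N n B V8 P : nat) : seq nat :=
  [:: 0; r1; 0; r3; 0; r5; 0; r7; 0; N; n; B; V8; 0; P; 0; 0; 0].

(** A crude common bound for the operands of the setup arithmetic; the last summand exceeds the
    constant factor 8. *)
Definition setup_max : nat := N + B + V * 8 + n + n ^ d + n ^ d * a + a + K1 + K2 + B * B + J + 9.
Definition unit_time : nat := 20 * (setup_max * setup_max) + 20.
Local Notation X := setup_max.
Local Notation U := unit_time.

Lemma le_unit_time x y : x <= X -> y <= X ->
  [/\ x * (10 * y + 10) + 3 <= U, 10 * x + 3 <= U & x * 4 + 1 <= U].
Proof.
move=> lx ly; have X9 : 9 <= X by rewrite /setup_max; lia.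
have xyX : x * y <= X * X by apply: leq_mul.
have xX : x <= X * X by apply: leq_trans lx _; rewrite leq_pmulr //; lia.
by rewrite /unit_time; split; lia.
Qed.

Lemma runs_mul_eq rs1 rs2 i o x y : size rs1 = 18 -> x < 18 -> y < 18 ->
  uniq [:: x; y; 13; 16] -> nth 0 rs1 13 = 0 -> nth 0 rs1 16 = 0 ->
  nth 0 rs1 x <= X -> nth 0 rs1 y <= X ->
  rs2 = set_nth 0 rs1 x (nth 0 rs1 x * nth 0 rs1 y) ->
  runs w (mul x y 13 16) (Store rs1 i o) (Store rs2 i o) U.
Proof.
move=> sz lx ly u z0 l0 leX leY ->; have [le _ _] := le_unit_time leX leY.
by apply: runs_le le _; apply: runs_mul; rewrite ?sz.
Qed.

Lemma runs_add_unit rs1 rs2 i o x y : size rs1 = 18 -> x < 18 -> y < 18 ->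
  [&& x != y, x != 13 & y != 13] -> nth 0 rs1 13 = 0 -> nth 0 rs1 y <= X ->
  rs2 = set_nth 0 rs1 x (nth 0 rs1 x + nth 0 rs1 y) ->
  runs w (add x y 13) (Store rs1 i o) (Store rs2 i o) U.
Proof.
move=> sz lx ly u z0 leY E; have [_ le _] := le_unit_time leY leY.
exact: runs_add_eq E le.
Qed.

Lemma runs_mul_const rs1 rs2 i o x c : size rs1 = 18 -> x < 13 ->
  nth 0 rs1 13 = 0 -> nth 0 rs1 14 = 0 -> nth 0 rs1 16 = 0 ->
  nth 0 rs1 x <= X -> c <= X ->
  rs2 = set_nth 0 rs1 x (nth 0 rs1 x * c) ->
  runs w (mul_const x c) (Store rs1 i o) (Store rs2 i o) (3 * U + 2).
Proof.
move=> sz lx z13 z14 z16 leX lec ->; have [le1 le2 le3] := le_unit_time lec lec.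
apply: (@runs_le _ _ _ _ (U + (U + U + 1) + 1)); first by lia.
have x18 : x < 18 by lia.
apply: (@runs_seq _ _ _ _ (Store (set_nth 0 rs1 14 c) i o)).
  by apply: runs_inc_n_eq => //; rewrite ?z14 ?add0n //; lia.
have nx : (x == 14) = false by lia.
apply: (@runs_seq _ _ _ _ (Store (set_nth 0 (set_nth 0 rs1 x (nth 0 rs1 x * c)) 14 c) i o)).
  apply: runs_mul_eq; rewrite ?size_upd ?sz // ?nth_upd ?nx ?eqxx //.
    by rewrite /= !inE; lia.
  by rewrite set_set_nth nx.
apply: runs_clear_eq; rewrite ?size_upd ?size_upd ?sz ?nth_upd ?eqxx //; last by lia.
apply: regs_eq => [|k]; first by rewrite !size_upd ?size_upd ?sz.
rewrite !nth_upd; have [->|//] := eqVneq k 14; by rewrite eq_sym nx z14.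
Qed.

Lemma runs_length : runs w length_code (Store (nseq 18 0) 0 [::])
  (Store (setup_regs 0 0 0 0 0 n 0 0 0) 0 [::]) (3 * U + 2).
Proof.
have [_ le1 le2] : [/\ n * (10 * n + 10) + 3 <= U, 10 * n + 3 <= U & n * 4 + 1 <= U].
  by apply: le_unit_time; rewrite /setup_max; lia.
apply: (@runs_le _ _ _ _ (U + (U + U + 1) + 1)); first by lia.
apply: (@runs_seq _ _ _ _ (Store (setup_regs 0 0 0 0 0 n 0 0 0) n [::])).
  apply: runs_le le2 _.
  apply: (@runs_while w _ _ (fun k => Store (setup_regs 0 0 0 0 0 k 0 0 0) k [::])) => [k ltk|].
    split=> //; apply: (@runs_seq _ _ _ _ (Store (setup_regs 0 0 0 0 0 k 0 0 0) k.+1 [::]) _ 1 1).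
      exact: (@runs_update w InR).
    exact: (@runs_inc w (setup_regs 0 0 0 0 0 k 0 0 0) k.+1 [::] 10).
  by rewrite /= ltnn.
apply: (@runs_seq _ _ _ _ (Store (setup_regs 0 0 0 0 0 n 0 0 n) n [::])).
  by apply: runs_add_unit => //; rewrite /= /setup_max; lia.
apply: runs_le le2 _.
have := @runs_while w (NonZero 14) (Seq (Dec 14) InL)
  (fun k => Store (setup_regs 0 0 0 0 0 n 0 0 (n - k)) (n - k) [::]) n 3.
rewrite subnn subn0; apply=> [k ltk|] //.
split; first by rewrite /=; lia.
apply: (@runs_seq _ _ _ _ (Store (setup_regs 0 0 0 0 0 n 0 0 (n - k.+1)) (n - k) [::]) _ 1 1).
  by rewrite subnS; apply: (@runs_dec w (setup_regs 0 0 0 0 0 n 0 0 (n - k)) (n - k) [::] 14).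
have := @runs_update w InL (Store (setup_regs 0 0 0 0 0 n 0 0 (n - k.+1)) (n - k) [::]).
by rewrite /= -subnS; apply; lia.
Qed.

Lemma runs_bound : runs w bound_code (Store (setup_regs 0 0 0 0 0 n 0 0 0) 0 [::])
  (Store (setup_regs 0 0 0 0 0 n B 0 0) 0 [::]) (d * (U + 1) + 5 * U + 10).
Proof.
(* The extra 1 in the comparison with [n ^ d] is for the empty input, where [n ^ 0] may exceed
   [n ^ d]. *)
have leX k : k <= d -> n ^ k <= X.
  move=> lek; apply: (@leq_trans (n ^ d + 1)); last by rewrite /setup_max; lia.
  have [n0|n_gt0] := posnP n; last by rewrite -[n ^ k]addn0 leq_add // leq_pexp2l.
  by rewrite n0 addn1; case: k lek => [|k] _; rewrite ?expn0 // (exp0n (ltn0Sn k)).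
have nX : n <= X by rewrite /setup_max; lia.
have aX : a <= X by rewrite /setup_max; lia.
have [_ _ le4a] := le_unit_time aX aX.
apply: (@runs_le _ _ _ _ (1 + ((d * (U + 1) + 1) + ((3 * U + 2) + (U + 1 + 1) + 1) + 1) + 1)).
  by lia.
apply: (@runs_seq _ _ _ _ (Store (setup_regs 0 0 0 0 0 n 1 0 0) 0 [::])).
  exact: (@runs_inc w _ 0 [::] 11).
apply: (@runs_seq _ _ _ _ (Store (setup_regs 0 0 0 0 0 n (n ^ d) 0 0) 0 [::])).
  suff H m k : m + k <= d -> runs w (iter m (Seq (mul 11 10 13 16)) Skip)
      (Store (setup_regs 0 0 0 0 0 n (n ^ k) 0 0) 0 [::])
      (Store (setup_regs 0 0 0 0 0 n (n ^ (m + k)) 0 0) 0 [::]) (m * (U + 1) + 1).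
    by have := H d 0; rewrite addn0; apply.
  elim: m k => [|m IH] k lek; first exact: runs_skip.
  rewrite iterS; apply: (@runs_le _ _ _ _ (U + (m * (U + 1) + 1) + 1)); first by lia.
  apply: (@runs_seq _ _ _ _ (Store (setup_regs 0 0 0 0 0 n (n ^ k.+1) 0 0) 0 [::])).
    apply: runs_mul_eq => //; first by rewrite /=; apply: leX; lia.
    by rewrite expnSr.
  by rewrite addSnnS; apply: IH; lia.
apply: (@runs_seq _ _ _ _ (Store (setup_regs 0 0 0 0 0 n (n ^ d * a) 0 0) 0 [::])).
  by apply: runs_mul_const => //; apply: leX.
apply: (@runs_seq _ _ _ _ (Store (setup_regs 0 0 0 0 0 n (n ^ d * a + a) 0 0) 0 [::])).
  by apply: runs_inc_n_eq => //; lia.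
rewrite /bound [a * _]mulnC.
exact: (@runs_inc w (setup_regs 0 0 0 0 0 n (n ^ d * a + a) 0 0) 0 [::] 11).
Qed.

Lemma runs_row_size : runs w row_size_code (Store (setup_regs 0 0 0 0 0 n B 0 0) 0 [::])
  (Store (setup_regs 0 0 0 0 0 n B (V * 8) 0) 0 [::]) (8 * U + 10).
Proof.
apply: (@runs_le _ _ _ _ (U + (U + ((3 * U + 2) + (3 * U + 2) + 1) + 1) + 1)).
  by lia.
have BX : B <= X by rewrite /setup_max; lia.
have BBX : B * B <= X by rewrite /setup_max; lia.
have KX : K2 <= X by rewrite /setup_max; lia.
have VX : V <= X by rewrite /setup_max; lia.
have X8 : 8 <= X by rewrite /setup_max; lia.
apply: (@runs_seq _ _ _ _ (Store (setup_regs 0 0 0 0 0 n B B 0) 0 [::])).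
  exact: runs_add_unit.
apply: (@runs_seq _ _ _ _ (Store (setup_regs 0 0 0 0 0 n B (B * B) 0) 0 [::])).
  exact: runs_mul_eq.
apply: (@runs_seq _ _ _ _ (Store (setup_regs 0 0 0 0 0 n B V 0) 0 [::])).
  exact: runs_mul_const.
exact: runs_mul_const.
Qed.

Lemma runs_order : runs w order_code (Store (setup_regs 0 0 0 0 0 n B (V * 8) 0) 0 [::])
  (Store (setup_regs 0 0 0 0 N n B (V * 8) 0) 0 [::]) (8 * U + 10).
Proof.
apply: (@runs_le _ _ _ _ (U + (U + ((3 * U + 2) + (U + 1 + 1) + 1) + 1) + 1)).
  by lia.
have BX : B <= X by rewrite /setup_max; lia.
have BBX : B * B <= X by rewrite /setup_max; lia.
have KX : K1 <= X by rewrite /setup_max; lia.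
have JX : J <= X by rewrite /setup_max; lia.
have VX : V * 8 <= X by rewrite /setup_max; lia.
apply: (@runs_seq _ _ _ _ (Store (setup_regs 0 0 0 0 B n B (V * 8) 0) 0 [::])).
  exact: runs_add_unit.
apply: (@runs_seq _ _ _ _ (Store (setup_regs 0 0 0 0 (B * B) n B (V * 8) 0) 0 [::])).
  exact: runs_mul_eq.
apply: (@runs_seq _ _ _ _ (Store (setup_regs 0 0 0 0 J n B (V * 8) 0) 0 [::])).
  exact: runs_mul_const.
apply: (@runs_seq _ _ _ _ (Store (setup_regs 0 0 0 0 N n B (V * 8) 0) 0 [::])); last exact: runs_skip.
by apply: runs_mul_eq => //; rewrite /gadget_order -mulnA.
Qed.

Definition header : word := unary N ++ unary 23 ++ unary 2 ++ unary 4.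

Lemma runs_emits (s : seq bool) rs i o :
  runs w (seqs [seq Emit b | b <- s]) (Store rs i o) (Store rs i (o ++ s)) (size s * 2 + 1).
Proof.
elim: s o => [|b s IH] o /=; first by rewrite cats0; apply: runs_skip.
rewrite (_ : _ * 2 + 1 = 1 + (size s * 2 + 1) + 1); last by lia.
apply: (@runs_seq _ _ _ _ (Store rs i (rcons o b))); first exact: (@runs_update w (Emit b)).
by rewrite -cat_rcons; apply: IH.
Qed.

Lemma runs_header : runs w header_code (Store (setup_regs 0 0 0 0 N n B (V * 8) 0) 0 [::])
  (Store (loop_regs w B N (V * 8) 0 0 0 0 0 0 0) 0 header) (6 * U + 200).
Proof.
have BX : B <= X by rewrite /setup_max; lia.
have NX : N <= X by rewrite /setup_max; lia.
have [_ _ leN] := le_unit_time NX NX.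
(* 33 = 1 + 24 + 3 + 5 bits: the end of the first unary number, then the codes of 23, 2 and 4. *)
apply: (@runs_le _ _ _ _ (U + (U + (U + (U + (U + (U + (33 * 2 + 1) + 1) + 1) + 1) + 1) + 1) + 1)).
  by lia.
rewrite /loop_regs subn0 -/(setup_regs B B B B N n B (V * 8) 0).
apply: (@runs_seq _ _ _ _ (Store (setup_regs B 0 0 0 N n B (V * 8) 0) 0 [::])).
  exact: runs_add_unit.
apply: (@runs_seq _ _ _ _ (Store (setup_regs B B 0 0 N n B (V * 8) 0) 0 [::])).
  exact: runs_add_unit.
apply: (@runs_seq _ _ _ _ (Store (setup_regs B B B 0 N n B (V * 8) 0) 0 [::])).
  exact: runs_add_unit.
apply: (@runs_seq _ _ _ _ (Store (setup_regs B B B B N n B (V * 8) 0) 0 [::])).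
  exact: runs_add_unit.
apply: (@runs_seq _ _ _ _ (Store (setup_regs B B B B N n B (V * 8) N) 0 [::])).
  exact: runs_add_unit.
apply: (@runs_seq _ _ _ _ (Store (setup_regs B B B B N n B (V * 8) 0) 0 (nseq N true))).
  apply: runs_le leN _.
  exact: (@runs_emit_all w (setup_regs B B B B N n B (V * 8) N) 0 [::] 14 true).
have -> : header = nseq N true ++ (false :: unary 23 ++ unary 2 ++ unary 4).
  by rewrite /header {1}/unary cat_rcons.
exact: (runs_emits (false :: unary 23 ++ unary 2 ++ unary 4)).
Qed.

Hypotheses (K1_gt0 : 0 < K1) (K2_gt0 : 0 < K2).

Definition program_output : word :=
  header ++ flatten [seq flatten [seq vertex_row K1 K2 tbl w B t u | u <- iota 0 N]
                    | t <- iota 0 23].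

Definition program_time : nat :=
  d * (U + 1) + 30 * U + 300 + 23 * (snapshot_time K1 K2 w B + 1).

Lemma runs_program : exists2 s, outp s = program_output &
  runs w program (Store (nseq 18 0) 0 [::]) s program_time.
Proof.
exists (Store (loop_regs w B N (V * 8) 0 0 0 0 0 0 0) 0 program_output) => //.
apply: (@runs_le _ _ _ _ ((3 * U + 2) + ((d * (U + 1) + 5 * U + 10) + ((8 * U + 10) +
  ((8 * U + 10) + ((6 * U + 200) + (23 * (snapshot_time K1 K2 w B).+1 + 1) + 1)
   + 1) + 1) + 1) + 1)); first by rewrite /program_time; lia.
apply: runs_seq runs_length _.
apply: runs_seq runs_bound _.
apply: runs_seq runs_row_size _.
apply: runs_seq runs_order _.
apply: runs_seq runs_header _.
pose S t := Store (loop_regs w B N (V * 8) 0 0 0 0 0 0 0) 0 (header ++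
  flatten [seq flatten [seq vertex_row K1 K2 tbl w B t u | u <- iota 0 N]
          | t <- iota 0 t]).
have := @runs_seqs w _ (iota 0 23) (snapshot_code K1 K2 tbl) S
  (snapshot_time K1 K2 w B).
have -> : S 0 = Store (loop_regs w B N (V * 8) 0 0 0 0 0 0 0) 0 header.
  by rewrite /S /= cats0.
rewrite size_iota; apply=> t x0 ltt.
rewrite nth_iota // add0n /S -[t.+1]addn1 iotaD map_cat flatten_cat /= cats0 catA.
have := @runs_snapshot K1 K2 tbl w B K1_gt0 K2_gt0 isT t
  (header ++ flatten [seq flatten [seq vertex_row K1 K2 tbl w B t u | u <- iota 0 N]
          | t <- iota 0 t]) ltt.
by rewrite /snapshot_store /= cats0.
Qed.

End Program.

(** * Polynomial bounds on the running time *)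

Definition poly_bounded (f : word -> nat) : Prop :=
  exists a d, forall w, f w <= a * size w ^ d + a.

Lemma poly_const c : poly_bounded (fun=> c).
Proof. by exists c, 0 => w; rewrite leq_addl. Qed.

Lemma poly_size_exp d : poly_bounded (fun w => size w ^ d).
Proof. by exists 1, d => w; rewrite mul1n leq_addr. Qed.

Lemma poly_size : poly_bounded (fun w => size w).
Proof. by exists 1, 1 => w; rewrite mul1n leq_addr. Qed.

(** The 1 accounts for [n = 0] and [d = 0], where the left side is 1 and the power on the right may
    vanish. *)
Lemma expn_le_add (n d e : nat) : n ^ d <= n ^ (d + e) + 1.
Proof.
have [->|n_gt0] := posnP n.
  by case: d => [|d]; rewrite ?expn0 ?addn1 // (exp0n (ltn0Sn d)).
by apply: leq_trans (leq_addr 1 _); rewrite leq_pexp2l ?leq_addr.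
Qed.

Lemma poly_add f g :
  poly_bounded f -> poly_bounded g -> poly_bounded (fun w => f w + g w).
Proof.
case=> a [d fP] [b [e gP]]; exists (2 * (a + b)), (d + e) => w.
have := expn_le_add (size w) d e; have := expn_le_add (size w) e d.
rewrite [e + d]addnC; move: (fP w) (gP w).
move: (size w ^ d) (size w ^ e) (size w ^ (d + e)) => x y z.
by nia.
Qed.

Lemma poly_mul f g :
  poly_bounded f -> poly_bounded g -> poly_bounded (fun w => f w * g w).
Proof.
case=> a [d fP] [b [e gP]]; exists (3 * (a * b)), (d + e) => w.
apply: leq_trans (leq_mul (fP w) (gP w)) _.
have xz := expn_le_add (size w) d e; have yz := expn_le_add (size w) e d.
rewrite [e + d]addnC in yz; have Ez := expnD (size w) d e.
move: (size w ^ d) (size w ^ e) (size w ^ (d + e)) xz yz Ez => x y z xz yz Ez.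
have -> : (a * x + a) * (b * y + b) = a * b * (x * y + x + y + 1) by lia.
have -> : 3 * (a * b) * z + 3 * (a * b) = a * b * (3 * z + 3) by lia.
by rewrite leq_mul2l -Ez; apply/orP; right; lia.
Qed.

Lemma poly_succ f : poly_bounded f -> poly_bounded (fun w => (f w).+1).
Proof.
move=> fP; have [a [d H]] := poly_add fP (poly_const 1).
by exists a, d => w; rewrite -addn1.
Qed.

Ltac poly := lazymatch goal with
  | |- poly_bounded (fun _ => ?c) => exact: (poly_const c)
  | |- poly_bounded (fun w => size w) => exact: poly_size
  | |- poly_bounded (fun w => size w ^ ?d) => exact: (poly_size_exp d)
  | |- poly_bounded (fun w => @?f w + @?g w) => apply: (@poly_add f g); poly
  | |- poly_bounded (fun w => @?f w * @?g w) => apply: (@poly_mul f g); poly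
  | |- poly_bounded (fun w => (@?f w).+1) => apply: (@poly_succ f); poly
  | |- _ => assumption
  end.

Lemma poly_program_time a d K1 K2 :
  poly_bounded (fun w => program_time a d K1 K2 w).
Proof.
have pB : poly_bounded (bound a d) by rewrite /bound; poly.
have pN : poly_bounded (fun w => gadget_order (bound a d w * bound a d w * K1)
                                   (bound a d w * bound a d w * K2)).
  by rewrite /gadget_order; poly.
have pU : poly_bounded (unit_time a d K1 K2).
  by rewrite /unit_time /setup_max; poly.
have pv : poly_bounded (fun w => vertex_time K1 K2 w (bound a d w)).
  by rewrite /vertex_time /maxreg; poly.
have pk : poly_bounded (fun w => time_k K1 K2 w (bound a d w)).
  by rewrite /time_k /time_t' /time_p' /time_c /time8; poly.
by rewrite /program_time /snapshot_time /time_p; poly.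
Qed.

(** * The printed word is the encoding of the gadget *)

Lemma rowE N x : (if x is Some m then m < N else true) ->
  row N x = [seq x == Some v | v <- iota 0 N].
Proof.
have falses s k (y : option nat) : (forall v, s <= v < s + k -> y != Some v) ->
    [seq y == Some v | v <- iota s k] = nseq k false.
  move=> H; apply: (@eq_from_nth _ false); rewrite size_map size_iota ?size_nseq //.
  move=> i lti; rewrite (nth_map 0) ?size_iota // nth_iota // nth_nseq lti.
  by apply: negbTE; apply: H; lia.
case: x => [m|] ltm /=; last by rewrite falses.
have EN : N = m + (1 + (N - m.+1)) by lia.
rewrite {2}EN !iotaD !map_cat /= !add0n eqxx !falses //=.
- by move=> v lev; apply/eqP=> -[?]; lia.
- by move=> v lev; apply/eqP=> -[?]; lia.
Qed.

Lemma map_enum_ord (T : Type) n (F : nat -> T) :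
  [seq F i | i : 'I_n <- enum 'I_n] = [seq F i | i <- iota 0 n].
Proof. by rewrite -val_enum_ord -map_comp. Qed.

Lemma encode_gadget J V (A : nat -> nat -> entry) (V_gt0 : 0 < V) :
  tvc_encode (gadget J A V_gt0) =
  (unary (gadget_order J V) ++ unary 23 ++ unary 2 ++ unary 4) ++
  flatten [seq flatten [seq row (gadget_order J V) (partner J V A t u)
                       | u <- iota 0 (gadget_order J V)] | t <- iota 0 23].
Proof.
rewrite /tvc_encode -!catA; do 4!congr (_ ++ _).
rewrite -(map_enum_ord 23 (fun t => flatten [seq row (gadget_order J V)
  (partner J V A t u) | u <- iota 0 (gadget_order J V)])).
congr flatten; apply: eq_map => t; rewrite /adjacency.
rewrite -(map_enum_ord _ (fun u => row (gadget_order J V) (partner J V A t u))).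
congr flatten; apply: eq_map => u.
rewrite rowE; last first.
  case E: partner => [m|] //.
  by have [] := partner_sym V_gt0 (ltn_ord t) (ltn_ord u) E.
rewrite -(map_enum_ord _ (fun v => partner J V A t u == Some v)).
by apply: eq_map => v; apply: mem_gadget_edges.
Qed.

Theorem theorem3p1 :
  NP_hard TVC /\
  NP_hard (restrict (P := TVC) (fun I : tvc_instance =>
    [&& lifetime I == 23, activity I == 2, max_length I == 4
      & max_snapshot_degree (tgraph I) <= 1])).
Proof.
suff H : NP_hard (restrict (P := TVC) (fun I : tvc_instance =>
    [&& lifetime I == 23, activity I == 2, max_length I == 4
      & max_snapshot_degree (tgraph I) <= 1])).
  (* The restricted problem keeps the encoding and the yes-instances, so forgetting the proof of the
     restriction turns a reduction to it into one to [TVC]. *)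
  split=> // L /H[f [fP fL]].
  by exists (fun w => sval (f w)).
move=> L /cook_levin[a [d [K1 [K2 [tbl [K1_gt0 K2_gt0 LP]]]]]].
pose B w := bound a d w.
have V_gt0 w : 0 < B w * B w * K2 by rewrite !muln_gt0 K2_gt0.
pose I w := gadget (B w * B w * K1) (tableau_cnf (B w) w K1 K2 tbl) (V_gt0 w).
have IP w : [&& lifetime (I w) == 23, activity (I w) == 2, max_length (I w) == 4
    & max_snapshot_degree (tgraph (I w)) <= 1].
  by rewrite !eqxx /=; apply: gadget_degree.
exists (fun w => exist _ (I w) (IP w)); split; last first.
  move=> w; apply: (iff_trans (LP w)).
  apply: (iff_trans (tableau_cnfP _ _ _ _ _)) => //.
  by apply: iff_sym; apply: gadgetP.
have [a' [d' timeP]] := poly_program_time a d K1 K2.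
apply: (@runs_poly_time _ 18 (program a d K1 K2 tbl) a' d') => w.
have [s out_s run_s] := runs_program a d tbl w K1_gt0 K2_gt0.
exists s; last exact: runs_le (timeP w) run_s.
by rewrite out_s /= encode_gadget.
Qed.
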